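(* Let $\mathcal{N}$ be an open subset of a Fréchet space $E$, $L\in C^\infty(\mathcal{N}\times E,\mathbb{R})$ a Lagrangian, $X\in C^\infty(\mathcal{N},E)$ a vector field on $\mathcal{N}$ and $F\in C^\infty(\mathcal{N})$. If $L$ is $X$-invariant up to $F$, then along every critical curve $c$ of $L$ the function $$t\longmapsto J_X\bigl(c(t),c'(t)\bigr)-F\bigl(c(t)\bigr)$$ is constant. In particular, if $L$ is $X$-invariant, then $J_X$ is a constant of the motion (constant along every critical curve).
   Context: Smoothness is in the convenient sense: a map between open subsets of Fréchet spaces is smooth if it sends smooth curves to smooth curves. $D_1L(g,k),D_2L(g,k)\in E'$ are the partial differentials of $L$. $L$ is $X$-invariant up to $F$ if for all $(g,k)\in\mathcal{N}\times E$, $$D_1L(g,k)\bigl(X(g)\bigr)+D_2L(g,k)\bigl(DX(g)(k)\bigr)=dF(g)(k);$$ when $F=0$, $L$ is called (infinitesimally) $X$-invariant. No flow of $X$ is assumed to exist. The Noether function of $X$ is $J_X\in C^\infty(\mathcal{N}\times E)$, $J_X(g,k):=D_2L(g,k)(X(g))$. Let $I\subset\mathbb{R}$ be an open interval. A variation with compact support of $c\in C^\infty(I,\mathcal{N})$ is a smooth map $c_\bullet\colon\mathbb{R}\times I\to\mathcal{N}$, $(s,t)\mapsto c_s(t)$, with $c_0=c$ and such that there is a compact $K\subset I$ with $c_s(t)=c(t)$ for all $s$ and all $t\notin K$. A smooth curve $c$ is critical for $L$ if for every variation with compact support $c_\bullet$ of $c$, and some (equivalently, any) relatively compact open $J\subset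 I$ containing $K$, $\frac{d}{ds}\big|_{s=0}\int_J L(c_s(t),c_s'(t))\,dt=0$, where $c_s'=\partial_tc_s$. *)

(* Defs.v *)
From HB Require Import structures.
From mathcomp Require Import all_boot all_order all_algebra.
From mathcomp Require Import all_classical all_reals all_analysis.
Set Implicit Arguments.
Unset Strict Implicit.
Unset Printing Implicit Defensive.
Import Order.TTheory GRing.Theory Num.Theory.
Import numFieldNormedType.Exports.

Local Open Scope classical_set_scope.
Local Open Scope ring_scope.

(* [tvsType R] is the type of locally convex topological vector spaces.  Its
   uniform structure is only required to induce the topology, it need not be
   the translation-invariant one; completeness is therefore expressed here with
   a translation-invariant metric and not with the library's [cauchy]. *)
Definition invariant_metric (R : realType) (E : tvsType R)
    (d : E -> E -> R) : Prop :=
  [/\ forall x y, d x y = 0 <-> x = y,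
      forall x y, d x y = d y x,
      forall x y z, d x z <= d x y + d y z &
      forall x y z, d (x + z) (y + z) = d x y].

Definition metrizes (R : realType) (E : tvsType R) (d : E -> E -> R) : Prop :=
  forall (x : E) (A : set E),
    nbhs x A <-> exists2 e : R, 0 < e & [set y | d x y < e] `<=` A.

Definition metric_complete (R : realType) (E : tvsType R)
    (d : E -> E -> R) : Prop :=
  forall u : nat -> E,
    (forall e : R, 0 < e -> exists m : nat,
       forall i j : nat, (m <= i)%N -> (m <= j)%N -> d (u i) (u j) < e) ->
    exists l : E, u @ \oo --> l.

Definition frechet (R : realType) (E : tvsType R) : Prop :=
  exists d : E -> E -> R,
    [/\ invariant_metric d, metrizes d & metric_complete d].

(* The library's [derivable] and [derive1] are restricted to normed spaces;
   these use the same difference quotient, in a locally convex space.  The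
   default value 0 is chosen where the derivative does not exist. *)
Definition is_curve_derive (R : realType) (E : tvsType R)
    (c : R -> E) (t : R) (v : E) : Prop :=
  (fun h : R => h^-1 *: (c (h + t) - c t)) @ 0^' --> v.

Definition curve_derivable (R : realType) (E : tvsType R)
    (c : R -> E) (t : R) : Prop :=
  exists v : E, is_curve_derive c t v.

Definition curve_derive (R : realType) (E : tvsType R)
    (c : R -> E) (t : R) : E :=
  xget 0 [set v | is_curve_derive c t v].

(* Maps are total; on an open [I] only the values of [c] on [I] matter. *)
Definition smooth_curve (R : realType) (E : tvsType R)
    (I : set R) (c : R -> E) : Prop :=
  forall (n : nat) (t : R), I t -> curve_derivable (iter n (@curve_derive R E) c) t.

Definition smooth_map (R : realType) (E G : tvsType R)
    (U : set E) (f : E -> G) : Prop :=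
  forall c : R -> E, smooth_curve setT c -> (forall t, U (c t)) ->
    smooth_curve setT (f \o c).

Definition differential (R : realType) (E G : tvsType R)
    (f : E -> G) (g k : E) : G :=
  curve_derive (fun s : R => f (g + s *: k)) 0.

Definition D1 (R : realType) (E : tvsType R) (L : E * E -> R^o)
    (g k : E) : E -> R^o :=
  differential (fun g' : E => L (g', k)) g.

Definition D2 (R : realType) (E : tvsType R) (L : E * E -> R^o)
    (g k : E) : E -> R^o :=
  differential (fun k' : E => L (g, k')) k.

Definition invariant_up_to (R : realType) (E : tvsType R) (N : set E)
    (L : E * E -> R^o) (X : E -> E) (F : E -> R^o) : Prop :=
  forall g k : E, N g ->
    D1 L g k (X g) + D2 L g k (differential X g k) = differential F g k.

Definition infinitesimally_invariant (R : realType) (E : tvsType R) (N : set E)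
    (L : E * E -> R^o) (X : E -> E) : Prop :=
  invariant_up_to N L X (fun=> 0).

Definition noether (R : realType) (E : tvsType R)
    (L : E * E -> R^o) (X : E -> E) (p : E * E) : R :=
  D2 L p.1 p.2 (X p.1).

Definition velocity_lift (R : realType) (E : tvsType R) (c : R -> E) (t : R) :
    E * E :=
  (c t, curve_derive c t).

(* [cs (s, t)] is c_s(t). *)
Definition compact_variation (R : realType) (E : tvsType R) (N : set E)
    (I : set R) (c : R -> E) (cs : R^o * R^o -> E) (K : set R) : Prop :=
  [/\ smooth_map ([set: R^o] `*` (I : set R^o)) cs,
      (forall s t : R, I t -> N (cs (s, t))),
      (forall t : R, I t -> cs (0, t) = c t),
      compact K /\ K `<=` I &
      forall s t : R, I t -> ~ K t -> cs (s, t) = c t].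

Definition lagrangian_action (R : realType) (E : tvsType R) (L : E * E -> R^o)
    (J : set R) (c : R -> E) : R :=
  \int[lebesgue_measure]_(t in J) (L (velocity_lift c t) : R).

Definition critical (R : realType) (E : tvsType R) (N : set E)
    (L : E * E -> R^o) (I : set R) (c : R -> E) : Prop :=
  [/\ smooth_curve I c,
      (forall t : R, I t -> N (c t)) &
      forall (cs : R^o * R^o -> E) (K : set R),
        compact_variation N I c cs K ->
        exists J : set R,
          [/\ open J, compact (closure J), closure J `<=` I, K `<=` J &
              is_derive (0 : R) (1 : R)
                (fun s : R => lagrangian_action L J (fun t : R => cs (s, t))) (0 : R)]].

Definition constant_along_critical (R : realType) (E : tvsType R) (N : set E)
    (L : E * E -> R^o) (Q : E * E -> R) : Prop :=
  forall (I : set R) (c : R -> E), open I -> is_interval I ->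
    critical N L I c ->
    forall t1 t2 : R, I t1 -> I t2 ->
      Q (velocity_lift c t1) = Q (velocity_lift c t2).

(* Main.v *)
(** Along a critical curve [c], use the variation [c + d sin(s) phi(t) X(c(t))]
    with [phi] of compact support.  By invariance the derivative of the action
    at [s = 0] is the integral of [phi (F o c)' + phi' J], that is, of
    [phi' (J - F o c)]; taking for [phi] a difference of two smooth steps forces
    [J - F o c] to take the same value at any two instants.

    Smoothness being tested on curves only, the calculus behind this (chain rule,
    additivity of the differential, uniform first order expansions of [L] along
    the variation) rests on one fact: the second directional derivatives of a
    smooth map are locally bounded when base points and directions range over a
    bounded set.  Otherwise some smooth curve, passing through rapidly converging
    bad points, would have an image with an unbounded derivative. *)
Require Import Defs.
From HB Require Import structures.
From mathcomp Require Import all_boot all_order all_algebra.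
From mathcomp Require Import all_classical all_reals all_analysis.
From mathcomp Require Import ring lra.
Set Implicit Arguments.
Unset Strict Implicit.
Unset Printing Implicit Defensive.
Import Order.TTheory GRing.Theory Num.Theory.
Import numFieldNormedType.Exports.

Local Open Scope classical_set_scope.
Local Open Scope ring_scope.

(** A variation must stay in [N] for every real [s], whereas a tube around a compact piece of the
    curve only allows displacements up to some [d]. Since sin has values in [-1, 1] and derivative 1
    at 0, the factor [d * sin s] never leaves the tube and still starts with speed [d]. The action
    is never differentiated under the integral sign. Criticality already says that its derivative at
    0 exists and vanishes, so a strictly negative upper bound on the difference quotient for small
    [s > 0] is enough for a contradiction. This takes only a one-sided pointwise estimate, uniform
    over a compact interval, whose right-hand side has an explicit primitive [W]. For the same
    reason the integral of phi' (J - F o c) is not computed: near the two instants J - F o c is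
    compared with its values there up to an error [e], which uses no more than its continuity. *)

(** * Differentiation rules for curves in a locally convex space *)

Section CurveDerivative.
Variable R : realType.

Lemma cvg_tvsD (T : Type) (F : set_system T) (FF : Filter F) (E : tvsType R)
    (f g : T -> E) (a b : E) :
  f @ F --> a -> g @ F --> b -> (fun x => f x + g x) @ F --> a + b.
Proof.
move=> fa gb.
exact: (continuous2_cvg FF (h := fun x y => x + y) (@add_continuous E (a, b))).
Qed.

Lemma cvg_tvsZ (T : Type) (F : set_system T) (FF : Filter F) (E : tvsType R)
    (f : T -> R^o) (g : T -> E) (a : R^o) (b : E) :
  f @ F --> a -> g @ F --> b -> (fun x => f x *: g x) @ F --> a *: b.
Proof.
move=> fa gb.
exact: (continuous2_cvg FF (V := R^o) (h := fun x y => x *: y)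
  (@scale_continuous R E (a, b))).
Qed.

(* Caratheodory's form of differentiability: the slope [q] is continuous at 0,
   which turns every differentiation rule into an identity between slopes. *)
Lemma is_curve_deriveP (E : tvsType R) (c : R -> E) (t : R) (v : E) :
  is_curve_derive c t v <->
  exists q : R -> E, [/\ q @ (0 : R^o) --> v, q 0 = v &
    forall h, c (h + t) = c t + h *: q h].
Proof.
split=> [cv|[q [qv q0 qE]]].
  exists (fun h => if h == 0 then v else h^-1 *: (c (h + t) - c t)).
  split=> [||h]; last 2 first.
  - by rewrite eqxx.
  - case: eqP => [->|/eqP h0]; first by rewrite add0r scale0r addr0.
    by rewrite scalerA divff// scale1r [RHS]addrC subrK.
  move=> U /= Uv; have cU : nbhs (0 : R^o)
      [set h | h != 0 -> U (h^-1 *: (c (h + t) - c t))] := cv U Uv.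
  apply: (@filterS _ (nbhs (0 : R^o)) _ _ _ _ cU) => h /= H.
  by case: eqP => [_|/eqP //]; exact: nbhs_singleton.
move=> U /qv qU.
suff : nbhs (0 : R^o) [set h | h != 0 -> U (h^-1 *: (c (h + t) - c t))] by [].
apply: (@filterS _ (nbhs (0 : R^o)) _ _ _ _ qU) => h Uq h0 /=.
by rewrite qE [X in X - _]addrC addrK scalerA mulVf// scale1r.
Qed.

Lemma is_curve_derive_unique (E : tvsType R) (c : R -> E) (t : R) (v w : E) :
  hausdorff_space E -> is_curve_derive c t v -> is_curve_derive c t w -> v = w.
Proof.
move=> hE cv cw; exact: (@cvg_unique E hE _ _ v w cv cw).
Qed.

Lemma curve_deriveE (E : tvsType R) (c : R -> E) (t : R) (v : E) :
  hausdorff_space E -> is_curve_derive c t v -> curve_derive c t = v.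
Proof.
move=> hE cv; apply: (@is_curve_derive_unique _ c t) => //.
exact: (@xgetI _ 0 _ v).
Qed.

Lemma curve_derivableE (E : tvsType R) (c : R -> E) (t : R) :
  curve_derivable c t -> is_curve_derive c t (curve_derive c t).
Proof. by move=> [v cv]; exact: (@xgetI _ 0 _ v). Qed.

Lemma near_is_curve_derive (E : tvsType R) (c d : R -> E) (t : R) (v : E) :
  (\forall s \near (t : R^o), c s = d s) ->
  is_curve_derive c t v -> is_curve_derive d t v.
Proof.
move=> cd cv; have cdt : c t = d t by exact: (nbhs_singleton cd).
apply: cvg_trans cv; apply: near_eq_cvg; apply: nbhs_dnbhs.
have H : (fun h : R^o => (h + t : R^o)) @ (0 : R^o) --> (t : R^o).
  have {2}-> : t = 0 + t by rewrite add0r.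
  by apply: cvgD; [exact: cvg_id|exact: cvg_cst].
by apply: (@filterS _ (nbhs (0 : R^o)) _ _ _ _ (H _ cd)) => h /= ->; rewrite cdt.
Qed.

(** Valid even where no derivative exists: both sides choose from the same set of candidates, with
    the same default. *)
Lemma near_curve_derive (E : tvsType R) (c d : R -> E) (t : R) :
  (\forall s \near (t : R^o), c s = d s) -> curve_derive c t = curve_derive d t.
Proof.
move=> cd; rewrite /curve_derive; congr (xget 0 _); apply/seteqP; split=> v /=.
  exact: near_is_curve_derive.
apply: near_is_curve_derive; apply: filterS cd => s; exact: esym.
Qed.

Lemma is_curve_derive_continuous (E : tvsType R) (c : R -> E) (t : R) (v : E) :
  is_curve_derive c t v -> {for t, continuous (c : R^o -> E)}.
Proof.
move=> /is_curve_deriveP [q [qv q0 qE]].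
have H : (fun h : R^o => c t + h *: q h) @ (0 : R^o) --> c t + 0 *: v.
  apply: cvg_tvsD; first exact: cvg_cst.
  by apply: cvg_tvsZ => //; exact: cvg_id.
have H2 : (fun s : R^o => (s - t : R^o)) @ (t : R^o) --> (0 : R^o).
  rewrite -[X in _ --> X](subrr t).
  by apply: cvgB; [exact: cvg_id|exact: cvg_cst].
rewrite /prop_for /continuous_at.
have -> : (c : R^o -> E) = (fun h : R^o => c t + h *: q h) \o (fun s => s - t).
  by apply/funext => s /=; rewrite -qE subrK.
rewrite /= subrr.
apply: cvg_comp H2 _; rewrite q0; exact: H.
Qed.

Lemma is_curve_derive_cst (E : tvsType R) (a : E) (t : R) :
  is_curve_derive (fun=> a) t 0.
Proof.
apply/is_curve_deriveP; exists (fun=> 0); split=> // [|h]; first exact: cvg_cst.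
by rewrite scaler0 addr0.
Qed.

Lemma is_curve_derive_id (t : R) : is_curve_derive (id : R -> R^o) t 1.
Proof.
apply/is_curve_deriveP; exists (fun=> 1); split=> // [|h]; first exact: cvg_cst.
by rewrite /GRing.scale /= mulr1 addrC.
Qed.

Lemma is_curve_deriveD (E : tvsType R) (c d : R -> E) (t : R) (v w : E) :
  is_curve_derive c t v -> is_curve_derive d t w ->
  is_curve_derive (fun s => c s + d s) t (v + w).
Proof.
move=> /is_curve_deriveP [q [qv q0 qE]] /is_curve_deriveP [r [rw r0 rE]].
apply/is_curve_deriveP; exists (fun h => q h + r h).
split=> [||h]; first exact: cvg_tvsD.
  by rewrite q0 r0.
by rewrite qE rE scalerDr addrACA.
Qed.

Lemma is_curve_deriveZ (E : tvsType R) (a : R -> R^o) (c : R -> E) (t : R)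
    (a' : R^o) (v : E) :
  is_curve_derive a t a' -> is_curve_derive c t v ->
  is_curve_derive (fun s => a s *: c s) t (a' *: c t + a t *: v).
Proof.
move=> /is_curve_deriveP [q [qv q0 qE]] /is_curve_deriveP [r [rw r0 rE]].
apply/is_curve_deriveP.
exists (fun h => q h *: c t + (a t + h *: q h) *: r h); split=> [||h].
- apply: cvg_tvsD; first by apply: cvg_tvsZ => //; exact: cvg_cst.
  apply: cvg_tvsZ => //; rewrite -[X in _ --> X]addr0 -[X in _ --> _ + X](scale0r a').
  apply: cvg_tvsD; first exact: cvg_cst.
  by apply: cvg_tvsZ => //; exact: cvg_id.
- by rewrite q0 r0 scale0r addr0.
- rewrite qE rE scalerDr [X in X + _]scalerDl -addrA; congr (_ + _).
  rewrite scalerDr !scalerA; congr (_ + _ *: _).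
  by rewrite mulrC.
Qed.

Lemma is_curve_derive_comp (E : tvsType R) (c : R -> E) (b : R -> R^o) (t : R)
    (v : E) (b' : R^o) :
  is_curve_derive b t b' -> is_curve_derive c (b t) v ->
  is_curve_derive (fun s => c (b s)) t (b' *: v).
Proof.
move=> /is_curve_deriveP [q [qv q0 qE]] /is_curve_deriveP [r [rw r0 rE]].
apply/is_curve_deriveP; exists (fun h => q h *: r (h *: q h)); split=> [||h].
- apply: cvg_tvsZ => //.
  have H : (fun h : R^o => h *: q h) @ (0 : R^o) --> (0 : R^o).
    rewrite -[X in _ --> X](scale0r b'); apply: cvg_tvsZ => //; exact: cvg_id.
  exact: cvg_comp H rw.
- by rewrite q0 scale0r r0.
- by rewrite qE addrC rE scalerA.
Qed.

Lemma is_curve_derive_pair (E G : tvsType R) (c : R -> E) (d : R -> G) (t : R)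
    (v : E) (w : G) :
  is_curve_derive c t v -> is_curve_derive d t w ->
  is_curve_derive (fun s => (c s, d s)) t (v, w).
Proof. by move=> cv dw; apply: (cvg_pair cv dw). Qed.

Lemma is_curve_derive_lin (E G : tvsType R) (f : {linear E -> G}) (c : R -> E)
    (t : R) (v : E) :
  continuous f -> is_curve_derive c t v -> is_curve_derive (f \o c) t (f v).
Proof.
move=> fc /is_curve_deriveP [q [qv q0 qE]].
apply/is_curve_deriveP; exists (f \o q); split=> [||h] /=.
- exact: (cvg_comp _ _ qv (fc v)).
- by rewrite q0.
- by rewrite qE linearD linearZ.
Qed.

Lemma is_curve_derive_shift (E : tvsType R) (c : R -> E) (t u : R) (v : E) :
  is_curve_derive (fun s => c (u + s)) t v <-> is_curve_derive c (u + t) v.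
Proof.
rewrite /is_curve_derive; split; apply: cvg_trans; apply: near_eq_cvg;
  by apply: nearW => h; rewrite addrCA.
Qed.

End CurveDerivative.

Lemma hausdorff_prod (T U : topologicalType) :
  hausdorff_space T -> hausdorff_space U -> hausdorff_space (T * U)%type.
Proof.
move=> hT hU [x y] [x' y'] cl; congr pair.
  apply: hT => A B Ax Bx'.
  have HA : nbhs (x, y) (A `*` setT).
    by exists (A, setT) => //; split=> //; exact: (@filterT _ (nbhs y)).
  have HB : nbhs (x', y') (B `*` setT).
    by exists (B, setT) => //; split=> //; exact: (@filterT _ (nbhs y')).
  by have [[u v] [[Au _] [Bu _]]] := cl _ _ HA HB; exists u.
apply: hU => A B Ax Bx'.
have HA : nbhs (x, y) (setT `*` A).
  by exists (setT, A) => //; split=> //; exact: (@filterT _ (nbhs x)).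
have HB : nbhs (x', y') (setT `*` B).
  by exists (setT, B) => //; split=> //; exact: (@filterT _ (nbhs x')).
by have [[u v] [[_ Au] [_ Bu]]] := cl _ _ HA HB; exists v.
Qed.

(** * Closure properties of smooth curves *)

Section SmoothCurves.
Variable R : realType.
Implicit Types (I J : set R) (E G : tvsType R).

Lemma open_near I (t : R) (P : R -> Prop) :
  open I -> I t -> (forall s, I s -> P s) -> \forall s \near (t : R^o), P s.
Proof. by move=> oI It IP; exact: filterS IP (open_nbhs_nbhs (conj oI It)). Qed.

Lemma near_realP (t : R) (P : R -> Prop) :
  (\forall s \near (t : R^o), P s) <->
  (exists2 d : R, 0 < d & forall s, `|s - t| < d -> P s).
Proof.
split=> [H|[d d0 Hd]].
  have /(@nbhs_ballP R R^o) [d /= d0 Hd] : nbhs (t : R^o) P by [].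
  by exists d => // s sd; apply: Hd; rewrite /ball /= distrC.
apply/(@nbhs_ballP R R^o); exists d => //= s.
by rewrite /ball /= distrC => /Hd.
Qed.

Lemma iter_curve_derive_eq E I (c d : R -> E) :
  open I -> (forall t, I t -> c t = d t) -> forall n t, I t ->
  iter n (@curve_derive R E) c t = iter n (@curve_derive R E) d t.
Proof.
move=> oI cd; elim=> [|n IHn] t It /=; first exact: cd.
apply: near_curve_derive.
by apply: (open_near oI It) => s Is; exact: IHn.
Qed.

Lemma smooth_curveW E I J (c : R -> E) :
  J `<=` I -> smooth_curve I c -> smooth_curve J c.
Proof. by move=> JI sc n t /JI; exact: sc. Qed.

Lemma smooth_curve_local E I (c : R -> E) :
  (forall t, I t -> exists J (d : R -> E),
     [/\ open J, J t, smooth_curve J d & forall s, J s -> c s = d s]) ->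
  smooth_curve I c.
Proof.
move=> H n t /H [J [d [oJ Jt sd cd]]].
have [v dv] := sd n t Jt; exists v; apply: near_is_curve_derive dv.
apply: (open_near oJ Jt) => s Js.
exact/esym/(iter_curve_derive_eq oJ).
Qed.

Lemma smooth_curve_deriveP E I (c : R -> E) (t : R) :
  smooth_curve I c -> I t -> is_curve_derive c t (curve_derive c t).
Proof. by move=> sc It; exact/curve_derivableE/(sc 0). Qed.

Lemma smooth_curve_derive E I (c : R -> E) :
  smooth_curve I c -> smooth_curve I (curve_derive c).
Proof. by move=> sc n t It; rewrite -iterSr; exact: sc. Qed.

Lemma smooth_curve_iter E I (c : R -> E) n :
  smooth_curve I c -> smooth_curve I (iter n (@curve_derive R E) c).
Proof. by elim: n => //= n IHn /IHn; exact: smooth_curve_derive. Qed.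

Lemma smooth_curve_continuous E I (c : R -> E) (t : R) :
  smooth_curve I c -> I t -> {for t, continuous (c : R^o -> E)}.
Proof.
by move=> sc It; exact: is_curve_derive_continuous (smooth_curve_deriveP sc It).
Qed.

(** A class of curves stable under differentiation replaces closed formulas for iterated
    derivatives: by induction, each of these agrees on [I] with a member of the class. *)
Lemma smooth_curve_coind E I (P : (R -> E) -> Prop) (c : R -> E) :
  hausdorff_space E -> open I ->
  (forall c, P c -> exists2 d, P d & forall t, I t -> is_curve_derive c t (d t)) ->
  P c -> smooth_curve I c.
Proof.
move=> hE oI HP Pc n t It.
have [d [Pd cd]] : exists d, P d /\
    forall s, I s -> iter n (@curve_derive R E) c s = d s.
  elim: n => [|n [d [Pd cd]]]; first by exists c.
  have [d' Pd' dd'] := HP d Pd; exists d'; split=> // s Is /=.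
  rewrite (@near_curve_derive _ _ _ d).
    exact/curve_deriveE/dd'.
  by apply: (open_near oI Is) => u; exact: cd.
have [d' Pd' dd'] := HP d Pd; exists (d' t).
apply: near_is_curve_derive (dd' t It).
by apply: (open_near oI It) => u /cd.
Qed.

(** The Leibniz rule turns a product into a sum of two products, so a class of products is stable
    under differentiation only up to finite sums. *)
Inductive sum_closure E (P : (R -> E) -> Prop) : (R -> E) -> Prop :=
| sum_closure_base c : P c -> sum_closure P c
| sum_closure_add c d : sum_closure P c -> sum_closure P d ->
    sum_closure P (fun t => c t + d t).

Lemma smooth_curve_coind_sum E I (P : (R -> E) -> Prop) (c : R -> E) :
  hausdorff_space E -> open I ->
  (forall c, P c -> exists2 d, sum_closure P d &
     forall t, I t -> is_curve_derive c t (d t)) ->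
  P c -> smooth_curve I c.
Proof.
move=> hE oI HP Pc; apply: (@smooth_curve_coind E I (sum_closure P)) => //.
  move=> {Pc}c; elim=> [{}c /HP //|{}c d _ [c' Pc' cc'] _ [d' Pd' dd']].
  exists (fun t => c' t + d' t); first exact: sum_closure_add.
  by move=> t It; apply: is_curve_deriveD; [exact: cc'|exact: dd'].
exact: sum_closure_base.
Qed.

Lemma smooth_curve_cst E I (a : E) :
  hausdorff_space E -> open I -> smooth_curve I (fun=> a).
Proof.
move=> hE oI; apply: (@smooth_curve_coind E I (fun c => exists a, c = fun=> a)).
- by [].
- by [].
- move=> _ [b ->]; exists (fun=> 0); first by exists 0.
  by move=> t _; exact: is_curve_derive_cst.
- by exists a.
Qed.

Lemma smooth_curve_step E I (c d : R -> E) :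
  hausdorff_space E -> open I ->
  (forall t, I t -> is_curve_derive c t (d t)) -> smooth_curve I d ->
  smooth_curve I c.
Proof.
move=> hE oI cd sd [|n] t It; first by exists (d t); exact: cd.
rewrite iterSr; have [v dv] := sd n t It; exists v.
apply: near_is_curve_derive dv.
apply: (open_near oI It) => s Is.
apply: (iter_curve_derive_eq oI) => // u Iu.
exact/esym/curve_deriveE/cd.
Qed.

Lemma hausdorff_Ro : hausdorff_space (R^o : tvsType R).
Proof. exact: (@Rhausdorff R). Qed.
Hint Resolve hausdorff_Ro : core.

Lemma open_setTR : open (setT : set R).
Proof. exact: (@openT R). Qed.
Hint Resolve open_setTR : core.

Lemma smooth_curve_id I : open I -> smooth_curve I (id : R -> R^o).
Proof.
move=> oI; apply: (@smooth_curve_step R^o I _ (fun=> 1)) => //.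
  by move=> t _; exact: is_curve_derive_id.
exact: smooth_curve_cst.
Qed.

Lemma smooth_curveD E I (c d : R -> E) : hausdorff_space E -> open I ->
  smooth_curve I c -> smooth_curve I d -> smooth_curve I (fun t => c t + d t).
Proof.
move=> hE oI sc sd; apply: (@smooth_curve_coind E I (fun u => exists a b,
  [/\ smooth_curve I a, smooth_curve I b & u = fun t => a t + b t])) => //.
  move=> _ [a [b [sa sb ->]]].
  exists (fun t => curve_derive a t + curve_derive b t).
    by exists (curve_derive a), (curve_derive b); split=> //;
      exact: smooth_curve_derive.
  by move=> t It; apply: is_curve_deriveD; exact: smooth_curve_deriveP It.
by exists c, d.
Qed.

Lemma smooth_curveZ E I (a : R -> R^o) (c : R -> E) :
  hausdorff_space E -> open I ->
  smooth_curve I a -> smooth_curve I c -> smooth_curve I (fun t => a t *: c t).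
Proof.
move=> hE oI sa sc; apply: (@smooth_curve_coind_sum E I (fun u => exists (a : R -> R^o) (c : R -> E),
  [/\ smooth_curve I a, smooth_curve I c & u = fun t => a t *: c t])) => //.
  move=> _ [b [d [sb sd ->]]].
  exists (fun t => curve_derive b t *: d t + b t *: curve_derive d t).
    apply: sum_closure_add; apply: sum_closure_base.
      by exists (curve_derive b), d; split=> //; exact: smooth_curve_derive.
    by exists b, (curve_derive d); split=> //; exact: smooth_curve_derive.
  by move=> t It; apply: is_curve_deriveZ; exact: smooth_curve_deriveP It.
by exists a, c.
Qed.

Lemma smooth_curve_comp E I J (c : R -> E) (b : R -> R^o) :
  hausdorff_space E -> open I -> open J ->
  smooth_curve I b -> (forall t, I t -> J (b t)) -> smooth_curve J c ->
  smooth_curve I (fun t => c (b t)).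
Proof.
move=> hE oI oJ sb bJ sc.
(* The scalar factor [a] absorbs the derivatives of [b] that the chain rule produces. *)
apply: (@smooth_curve_coind_sum E I (fun u => exists (a : R -> R^o) (c : R -> E),
  [/\ smooth_curve I a, smooth_curve J c & u = fun t => a t *: c (b t)])) => //.
  move=> _ [a [d [sa sd ->]]].
  exists (fun t => curve_derive a t *: d (b t) +
                   (a t *: curve_derive b t) *: curve_derive d (b t)).
    apply: sum_closure_add; apply: sum_closure_base.
      by exists (curve_derive a), d; split=> //; exact: smooth_curve_derive.
    exists (fun t => a t *: curve_derive b t), (curve_derive d).
    split=> //; last exact: smooth_curve_derive.
    by apply: smooth_curveZ => //; exact: smooth_curve_derive.
  move=> t It; rewrite -scalerA.
  apply: is_curve_deriveZ; first exact: smooth_curve_deriveP It.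
  apply: is_curve_derive_comp; first exact: smooth_curve_deriveP It.
  exact/(smooth_curve_deriveP sd)/bJ.
exists (fun=> 1), c; split=> //; first exact: smooth_curve_cst.
by apply/funext => t; rewrite scale1r.
Qed.

Lemma smooth_curve_pair E G I (c : R -> E) (d : R -> G) :
  hausdorff_space E -> hausdorff_space G -> open I ->
  smooth_curve I c -> smooth_curve I d -> smooth_curve I (fun t => (c t, d t)).
Proof.
move=> hE hG oI sc sd; apply: (@smooth_curve_coind (E * G)%type I
  (fun u => exists a b,
    [/\ smooth_curve I a, smooth_curve I b & u = fun t => (a t, b t)])) => //.
- exact: hausdorff_prod.
- move=> _ [a [b [sa sb ->]]].
  exists (fun t => (curve_derive a t, curve_derive b t)).
    by exists (curve_derive a), (curve_derive b); split=> //;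
      exact: smooth_curve_derive.
  by move=> t It; apply: is_curve_derive_pair; exact: smooth_curve_deriveP It.
- by exists c, d.
Qed.

Lemma smooth_curve_lin E G I (f : {linear E -> G}) (c : R -> E) :
  hausdorff_space G -> open I -> continuous f ->
  smooth_curve I c -> smooth_curve I (fun t => f (c t)).
Proof.
move=> hG oI fc sc; apply: (@smooth_curve_coind G I
  (fun u => exists2 a, smooth_curve I a & u = fun t => f (a t))) => //.
- move=> _ [a sa ->]; exists (fun t => f (curve_derive a t)).
    by exists (curve_derive a) => //; exact: smooth_curve_derive.
  by move=> t It; apply: is_curve_derive_lin => //; exact: smooth_curve_deriveP It.
- by exists c.
Qed.

Lemma smooth_curve_fst E G I (c : R -> E * G) :
  hausdorff_space E -> open I ->
  smooth_curve I c -> smooth_curve I (fun t => (c t).1).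
Proof. by move=> hE oI; apply: smooth_curve_lin => // x; exact: cvg_fst. Qed.

Lemma smooth_curve_snd E G I (c : R -> E * G) :
  hausdorff_space G -> open I ->
  smooth_curve I c -> smooth_curve I (fun t => (c t).2).
Proof. by move=> hE oI; apply: smooth_curve_lin => // x; exact: cvg_snd. Qed.

Lemma smooth_curve_line E I (x v : E) : hausdorff_space E -> open I ->
  smooth_curve I (fun s : R => x + s *: v).
Proof.
move=> hE oI; apply: smooth_curveD => //; first exact: smooth_curve_cst.
by apply: smooth_curveZ => //; [exact: smooth_curve_id|exact: smooth_curve_cst].
Qed.

Lemma is_curve_derive_line E (x v : E) (t : R) :
  is_curve_derive (fun s : R => x + s *: v) t v.
Proof.
rewrite -[v in is_curve_derive _ _ v]add0r.
apply: is_curve_deriveD; first exact: is_curve_derive_cst.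
rewrite -[X in is_curve_derive _ _ X]addr0 -{2}[v]scale1r -(scaler0 _ t).
exact: is_curve_deriveZ (is_curve_derive_id t) (is_curve_derive_cst _ _).
Qed.

Lemma is_curve_derive_affine E (c : R -> E) (b e t : R) (v : E) :
  is_curve_derive c (b + t * e) v ->
  is_curve_derive (fun s => c (b + s * e)) t (e *: v).
Proof.
move=> cv.
exact: is_curve_derive_comp (@is_curve_derive_line R^o b e t) cv.
Qed.

Lemma iter_curve_derive_affine E I (c : R -> E) (b e : R) k (t : R) :
  hausdorff_space E -> open I -> smooth_curve I c -> I (b + t * e) ->
  iter k (@curve_derive R E) (fun s => c (b + s * e)) t =
    e ^+ k *: iter k (@curve_derive R E) c (b + t * e).
Proof.
move=> hE oI sc; elim: k t => [|k IHk] t It /=; first by rewrite expr0 scale1r.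
have nI : \forall s \near (t : R^o), I (b + s * e).
  have H : {for t, continuous (fun s : R^o => b + s * e : R^o)}.
    exact: is_curve_derive_continuous (@is_curve_derive_line R^o b e t).
  by have := H _ (open_nbhs_nbhs (conj oI It)).
rewrite (@near_curve_derive _ _ _
  (fun s => e ^+ k *: iter k (@curve_derive R E) c (b + s * e))); last first.
  by apply: filterS nI => s; exact: IHk.
apply: curve_deriveE => //.
have := is_curve_deriveZ (@is_curve_derive_cst R R^o (e ^+ k) t)
  (is_curve_derive_affine (smooth_curve_deriveP (smooth_curve_iter k sc) It)).
by rewrite scale0r add0r scalerA -exprSr.
Qed.

End SmoothCurves.
#[global] Hint Resolve hausdorff_Ro open_setTR : core.

(** * Smooth steps and plateaus on the line *)

Section SmoothStep.
Variable R : realType.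
Implicit Types (x s t : R).

Lemma is_curve_derive_is_derive (f : R -> R^o) t (v : R^o) :
  is_derive t (1 : R) (f : R -> R) (v : R) -> is_curve_derive f t v.
Proof.
move=> [df <-]; rewrite /is_curve_derive.
have -> : (fun h : R => h^-1 *: (f (h + t) - f t)) =
    (fun h : R => h^-1 *: ((f \o shift t) (h *: (1 : R)) - f t)).
  by apply/funext => h /=; rewrite /GRing.scale /= mulr1.
exact: df.
Qed.

Lemma is_derive_is_curve_derive (f : R -> R^o) t (v : R^o) :
  is_curve_derive f t v -> is_derive t (1 : R) (f : R -> R) (v : R).
Proof.
move=> fv.
have fv' : (fun h : R => h^-1 *: ((f \o shift t) (h *: (1 : R)) - f t)) @ 0^' --> v.
  rewrite (_ : (fun h => _) = (fun h : R => h^-1 *: (f (h + t) - f t)))//.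
  by apply/funext => h /=; rewrite /GRing.scale /= mulr1.
split; first by apply/cvg_ex; exists v.
exact: cvg_lim fv'.
Qed.

Lemma is_curve_deriveX (f : R -> R^o) t (v : R^o) k :
  is_curve_derive f t v ->
  is_curve_derive (fun s => f s ^+ k : R^o) t (k%:R * f t ^+ k.-1 * v).
Proof.
move=> fv; elim: k => [|k IHk].
  by rewrite !mul0r; exact: is_curve_derive_cst.
have -> : (fun s => f s ^+ k.+1 : R^o) = (fun s => f s *: (f s ^+ k : R^o)).
  by apply/funext => s; rewrite exprS.
have := is_curve_deriveZ fv IHk; rewrite /GRing.scale /=; congr is_curve_derive.
by case: k {IHk} => [|k]; rewrite /= ?exprS -?natr1; ring.
Qed.

Lemma is_curve_derive0_sqr (f : R -> R^o) t (C : R) :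
  f t = 0 -> (\forall h \near (0 : R^o), `|f (h + t)| <= C * h ^+ 2) ->
  is_curve_derive f t 0.
Proof.
move=> ft H; rewrite /is_curve_derive ft.
apply/cvgrPdist_le => e e0; near=> h.
rewrite sub0r normrN subr0 normrM normfV.
have h0 : h != 0 by near: h; exact: nbhs_dnbhs_neq.
have hp : 0 < `|h| by rewrite normr_gt0.
rewrite ler_pdivrMl//.
have fh : `|f (h + t)| <= C * h ^+ 2.
  by near: h; apply: nbhs_dnbhs; exact: H.
apply: le_trans fh _.
rewrite -[h ^+ 2]ger0_norm ?sqr_ge0// normrX expr2 mulrCA ler_pM2l//.
apply: le_trans (_ : (`|C| + 1) * `|h| <= _).
  by rewrite ler_pM2r// (le_trans (ler_norm _))// lerDl.
rewrite -ler_pdivlMl ?ltr_pwDr// mulrC.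
near: h; apply: nbhs_dnbhs.
apply: (@nbhs0_le R R); first by rewrite divr_gt0// ltr_pwDr.
Unshelve. all: by end_near. Qed.

(** The classical flat function is the case [k = 0]; the powers of [x^-1] are included because
    differentiation produces them. *)
Definition flat_exp (k : nat) : R -> R^o :=
  fun x => if 0 < x then x^-1 ^+ k * expR (- x^-1) else 0.

(** Raise [y / m <= expR (y / m)] to the power [m]. *)
Lemma powX_le_expR (m : nat) (y : R) : 0 <= y -> y ^+ m <= m%:R ^+ m * expR y.
Proof.
case: m => [|m] y0; first by rewrite !expr0 mul1r (le_trans _ (expR_ge1Dx y))// lerDl.
have m0 : 0 < m.+1%:R :> R by rewrite ltr0n.
have {2}-> : y = m.+1%:R * (y / m.+1%:R) by rewrite mulrC divfK// lt0r_neq0.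
rewrite expRM_natl -exprMn.
apply: lerXn2r; rewrite ?nnegrE//.
rewrite -ler_pdivrMl// mulrC (le_trans _ (expR_ge1Dx _))// lerDr//.
Qed.

(** The exponential is bounded with two more powers of [x^-1] than [k]; the two spare ones give the
    quadratic decay that makes the derivative at 0 vanish. *)
Lemma flat_exp_le (k : nat) x : `|flat_exp k x| <= k.+2%:R ^+ k.+2 * x ^+ 2.
Proof.
rewrite /flat_exp; case: ltP => [x0|_]; last by rewrite normr0 mulr_ge0 ?sqr_ge0// exprn_ge0.
have y0 : 0 < x^-1 by rewrite invr_gt0.
rewrite ger0_norm; last by rewrite mulr_ge0 ?expR_ge0// exprn_ge0// ltW.
have := powX_le_expR k.+2 (ltW y0).
rewrite expRN ler_pdivrMr ?expR_gt0// -addn2 exprD => H.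
rewrite mulrAC -ler_pdivrMr ?exprn_gt0// -exprVn//.
Qed.

Lemma is_curve_derive_flat_exp k x :
  is_curve_derive (flat_exp k) x (flat_exp k.+2 x - k%:R * flat_exp k.+1 x).
Proof.
have [x0|x0|->] := ltgtP x 0.
- apply: (@near_is_curve_derive R R^o (fun=> 0)).
    apply: (@open_near R [set y | y < 0]) => //.
    by move=> y /= y0; rewrite /flat_exp ltNge ltW.
  rewrite /flat_exp ltNge ltW//= mulr0 subr0; exact: is_curve_derive_cst.
- apply: (@near_is_curve_derive R R^o (fun y => y^-1 ^+ k * expR (- y^-1))).
    apply: (@open_near R [set y | 0 < y]) => //.
    by move=> y /= y0; rewrite /flat_exp y0.
  have xn0 : x != 0 by rewrite gt_eqF.
  have dV : is_derive x (1 : R) (fun y : R => y^-1) (- x ^- 2).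
    by apply: is_derive_eq (is_deriveV xn0 (is_derive_id x (1 : R))) _;
      rewrite /GRing.scale /= mulr1.
  have dE : is_derive x (1 : R) (fun y : R => expR (- y^-1)) (x ^- 2 * expR (- x^-1)).
    by apply: is_derive_eq; rewrite /GRing.scale /= opprK mulrC.
  have := is_curve_deriveZ (is_curve_deriveX (k := k) (is_curve_derive_is_derive dV))
    (is_curve_derive_is_derive dE).
  rewrite /GRing.scale /=; congr is_curve_derive; rewrite /flat_exp x0.
  case: k => [|k]; first by rewrite /= !mul0r subr0 add0r expr0 mul1r exprVn.
  by rewrite /= -!exprVn !exprS; ring.
- rewrite {2 3}/flat_exp ltxx mulr0 subr0.
  apply: (@is_curve_derive0_sqr _ _ (k.+2%:R ^+ k.+2)).
    by rewrite /flat_exp ltxx.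
  by apply: (@filterE _ (nbhs (0 : R^o))) => h; rewrite addr0; exact: flat_exp_le.
Qed.

Lemma smooth_curve_flat_exp k : smooth_curve setT (flat_exp k).
Proof.
apply: (@smooth_curve_coind_sum R R^o setT
  (fun u => exists (r : R) j, u = fun x => r *: flat_exp j x)) => //.
- move=> _ [r [j ->]].
  exists (fun x => r *: flat_exp j.+2 x + (- (r * j%:R)) *: flat_exp j.+1 x).
    apply: sum_closure_add; apply: sum_closure_base; first by exists r, j.+2.
    by exists (- (r * j%:R)), j.+1.
  move=> x _.
  have := is_curve_deriveZ (@is_curve_derive_cst R R^o r x)
    (@is_curve_derive_flat_exp j x).
  congr is_curve_derive; rewrite scale0r add0r /GRing.scale /=; ring.
- by exists 1, k; apply/funext => x; rewrite scale1r.
Qed.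

(** With g = [expR 1 * flat_exp 0], which is 0 up to 0, equals 1 at 1 and is nondecreasing, this is
    g (1 - g (- s)). For [s <= -1] the inner value is at least 1 and the outer argument nonpositive;
    for [s >= 0] the inner value is 0 and g 1 = 1 remains. A composition needs neither a quotient
    nor an integral. *)
Definition smooth_step : R -> R^o :=
  fun s => expR 1 * flat_exp 0 (1 - expR 1 * flat_exp 0 (- s)).

Lemma flat_exp0_ge1 x : 1 <= x -> 1 <= expR 1 * flat_exp 0 x.
Proof.
move=> x1; have x0 : 0 < x by rewrite (lt_le_trans _ x1).
rewrite /flat_exp x0 expr0 mul1r -expRD (le_trans _ (expR_ge1Dx _))// lerDl subr_ge0.
by rewrite invf_le1.
Qed.

Lemma smooth_step0 s : s <= -1 -> smooth_step s = 0.
Proof.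
move=> s1; rewrite /smooth_step {1}/flat_exp ltNge subr_le0 flat_exp0_ge1 ?mulr0//.
by rewrite lerNr.
Qed.

Lemma smooth_step1 s : 0 <= s -> smooth_step s = 1.
Proof.
move=> s0; rewrite /smooth_step [flat_exp 0 (- s)]/flat_exp.
rewrite ltNge oppr_le0 s0 /= mulr0 subr0 /flat_exp ltr01 expr0 mul1r invr1.
by rewrite -expRD subrr expR0.
Qed.

Lemma flat_exp0_le x y : x <= y -> flat_exp 0 x <= flat_exp 0 y.
Proof.
move=> xy; rewrite /flat_exp !expr0 !mul1r; case: ltP => x0.
  by rewrite (lt_le_trans x0 xy) ler_expR lerN2 lef_pV2 ?posrE ?(lt_le_trans x0).
by case: ifP => // _; exact: expR_ge0.
Qed.

Lemma smooth_step_le s t : s <= t -> smooth_step s <= smooth_step t.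
Proof.
move=> st; rewrite /smooth_step ler_pM2l ?expR_gt0// flat_exp0_le//.
by rewrite lerB// ler_pM2l ?expR_gt0// flat_exp0_le// lerN2.
Qed.

Lemma smooth_smooth_step : smooth_curve setT smooth_step.
Proof.
have oT := @openT R.
have S r u (c : R -> R^o) : smooth_curve setT c ->
    smooth_curve setT (fun s : R => u + r *: c s).
  move=> sc; apply: smooth_curveD => //; first exact: smooth_curve_cst.
  by apply: smooth_curveZ => //; exact: smooth_curve_cst.
have C (c d : R -> R^o) : smooth_curve setT c -> smooth_curve setT d ->
    smooth_curve setT (fun s => d (c s)).
  by move=> sc sd; apply: smooth_curve_comp sd.
have sN : smooth_curve setT (fun s : R => 0 + (-1) *: (s : R^o)).
  by apply: S; exact: smooth_curve_id.
have := S (expR 1) 0 _ (C _ _ (S (- expR 1) 1 _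
  (C _ _ sN (smooth_curve_flat_exp 0))) (smooth_curve_flat_exp 0)).
congr smooth_curve; apply/funext => s.
by rewrite /smooth_step add0r scaleN1r add0r /GRing.scale /= mulNr.
Qed.

(** It rises on [-1, -1/2] and falls on [1/2, 1]. *)
Definition plateau : R -> R^o :=
  fun s => smooth_step (2 * s + 1) - smooth_step (2 * s - 2).

Lemma plateau1 s : `|s| <= 2^-1 -> plateau s = 1.
Proof.
rewrite ler_norml => /andP[s1 s2]; rewrite /plateau smooth_step1; last by lra.
by rewrite smooth_step0 ?subr0//; lra.
Qed.

Lemma plateau0 s : 1 < `|s| -> plateau s = 0.
Proof.
rewrite /plateau lter_normr => /orP[s1|s1].
  by rewrite !smooth_step1 ?subrr//; lra.
by rewrite !smooth_step0 ?subrr//; lra.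
Qed.

Lemma plateau_ge0_le1 s : `|plateau s| <= 1.
Proof.
have H t : 0 <= smooth_step t <= 1.
  have [t1|t1] := leP t (-1); first by rewrite smooth_step0// lexx ler01.
  rewrite -{1}(@smooth_step0 (-1))// smooth_step_le ?(ltW t1)//=.
  have [t0|t0] := leP 0 t; first by rewrite smooth_step1.
  by rewrite -(@smooth_step1 0)// smooth_step_le// ltW.
rewrite /plateau ler_norml; move: (H (2 * s + 1)) (H (2 * s - 2)); lra.
Qed.

Lemma smooth_plateau : smooth_curve setT plateau.
Proof.
have oT := @openT R.
have S u (c : R -> R^o) : smooth_curve setT c ->
    smooth_curve setT (fun s : R => c (u + s *: 2)).
  by move=> sc; apply: smooth_curve_comp sc => //; exact: smooth_curve_line.
have /(_ (fun s => (-1) *: smooth_step (-2 + s *: 2))) :=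
  smooth_curveD _ oT (S 1 _ smooth_smooth_step).
move=> /(_ (@hausdorff_Ro R)) /(_ _)/wrap[].
  by apply: smooth_curveZ => //; [exact: smooth_curve_cst|exact: S smooth_smooth_step].
congr smooth_curve; apply/funext => s.
rewrite /plateau scaleN1r /GRing.scale /= [s * 2]mulrC.
by rewrite [1 + _]addrC [-2 + _]addrC.
Qed.

End SmoothStep.

(** * Continuous seminorms, gauges and the mean value inequality *)

Section Seminorms.
Variables (R : realType) (E : tvsType R).

(** Smallness near 0 suffices for continuity everywhere, by subadditivity. *)
Definition cseminorm (p : E -> R) : Prop :=
  [/\ forall x y, p (x + y) <= p x + p y,
      forall (r : R) x, p (r *: x) = `|r| * p x &
      forall e : R, 0 < e -> nbhs (0 : E) [set x | p x < e]].

Lemma cseminormD p x y : cseminorm p -> p (x + y) <= p x + p y.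
Proof. by case. Qed.

Lemma cseminormZ p (r : R) x : cseminorm p -> p (r *: x) = `|r| * p x.
Proof. by case. Qed.

Lemma cseminorm0 p : cseminorm p -> p 0 = 0.
Proof. by move=> /(@cseminormZ _ 0 0); rewrite scale0r normr0 mul0r. Qed.

Lemma cseminormN p x : cseminorm p -> p (- x) = p x.
Proof. by move=> /(@cseminormZ _ (-1) x); rewrite scaleN1r normrN normr1 mul1r. Qed.

Lemma cseminormB p x y : cseminorm p -> p (x - y) <= p x + p y.
Proof. by move=> hp; rewrite -(cseminormN y hp) cseminormD. Qed.

Lemma cseminorm_ge0 p x : cseminorm p -> 0 <= p x.
Proof.
move=> hp; have := cseminormB x x hp.
by rewrite subrr cseminorm0// -mulr2n pmulrn_lge0.
Qed.

Lemma cseminorm_distl p x y z : cseminorm p -> p (x - z) <= p (x - y) + p (y - z).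
Proof.
by move=> hp; rewrite (le_trans _ (cseminormD _ _ hp))// addrA subrK.
Qed.

Lemma cseminorm_le p x y : cseminorm p -> p x <= p y + p (x - y).
Proof.
by move=> hp; rewrite (le_trans _ (cseminormD _ _ hp))// addrC subrK.
Qed.

Lemma cvg_cseminorm (T : Type) (F : set_system T) (FF : Filter F)
    (f : T -> E) (l : E) p (e : R) :
  cseminorm p -> 0 < e -> f @ F --> l -> \forall x \near F, p (f x - l) < e.
Proof.
move=> [_ _ hp] e0 fl.
have H : (fun x => f x + - l) @ F --> l + - l.
  by apply: cvg_tvsD => //; exact: cvg_cst.
by have := H [set x | p x < e]; rewrite subrr => /(_ (hp _ e0)).
Qed.

Lemma cseminorm_continuous (c : R^o -> E) (t : R^o) p :
  cseminorm p -> {for t, continuous c} -> {for t, continuous (fun s => p (c s) : R)}.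
Proof.
move=> hp ct; apply/cvgrPdist_lt => e e0.
near=> s; have se : p (c s - c t) < e by near: s; exact: cvg_cseminorm.
rewrite distrC ltr_norml; have h1 := cseminorm_le (c s) (c t) hp.
have := cseminorm_le (c t) (c s) hp; rewrite -[c t - c s]opprB cseminormN//.
by move=> h2; apply/andP; split; lra.
Unshelve. all: by end_near. Qed.

Lemma nbhs0_absorb (U : set E) (x : E) : nbhs 0 U ->
  exists2 d : R, 0 < d & forall r : R, `|r| <= d -> U (r *: x).
Proof.
move=> U0; have H : (fun r : R^o => r *: x) @ (0 : R^o) --> (0 : R^o) *: x.
  by apply: cvg_tvsZ; [exact: cvg_id|exact: cvg_cst].
rewrite scale0r in H; have := H U U0.
move=> /(@nbhs_ballP R R^o) [e /= e0 He]; exists (e / 2); first exact: divr_gt0.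
move=> r re; apply: He; rewrite /ball /= sub0r normrN (le_lt_trans re)//.
by rewrite ltr_pdivrMr// ltr_pMr// ltr1n.
Qed.

(** The Minkowski functional of [V]. *)
Definition gauge (V : set E) (x : E) : R :=
  inf [set r : R | 0 < r /\ V (r^-1 *: x)].

Section Gauge.
Variable V : set E.
Hypothesis V0 : nbhs 0 V.
Hypothesis VN : forall x, V x -> V (- x).
Hypothesis Vconv : forall x y (l : R), V x -> V y -> 0 <= l <= 1 ->
  V (l *: x + (1 - l) *: y).

Let gset x : set R := [set r : R | 0 < r /\ V (r^-1 *: x)].

Let gset_inf x : has_inf (gset x).
Proof.
split; last by exists 0 => r [/ltW].
have [d d0 Hd] := nbhs0_absorb x V0.
exists d^-1; split; first by rewrite invr_gt0.
by apply: Hd; rewrite invrK ger0_norm// ltW.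
Qed.

Let gauge_le x r : 0 < r -> V (r^-1 *: x) -> gauge V x <= r.
Proof. by move=> r0 Vr; apply: ge_inf => //; exists 0 => s [/ltW]. Qed.

Let gauge_adh x e : 0 < e -> exists r, [/\ 0 < r, V (r^-1 *: x) & r < gauge V x + e].
Proof.
by move=> e0; have [r [r0 Vr] re] := inf_adherent e0 (gset_inf x); exists r.
Qed.

Let gaugeD x y : gauge V (x + y) <= gauge V x + gauge V y.
Proof.
apply/ler_addgt0Pr => e e0.
have e20 : 0 < e / 2 by rewrite divr_gt0.
have [r [r0 Vr rx]] := gauge_adh x e20.
have [s [s0 Vs sy]] := gauge_adh y e20.
apply: (@le_trans _ _ (r + s)); last by lra.
apply: gauge_le; first exact: addr_gt0.
have rs0 : r + s != 0 by rewrite gt_eqF// addr_gt0.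
(* The point (x + y) / (r + s) is the convex combination of x / r and y / s with weights r / (r + s)
   and s / (r + s). *)
have := @Vconv _ _ (r / (r + s)) Vr Vs.
have -> : 1 - r / (r + s) = s / (r + s) by field.
rewrite !scalerA scalerDr !(mulrAC _ (_ + _)^-1) !divff ?gt_eqF// !mul1r; apply.
apply/andP; split; first by rewrite divr_ge0 ?(ltW r0) ?(ltW (addr_gt0 r0 s0)).
by rewrite ler_pdivrMr ?addr_gt0// mul1r lerDl ltW.
Qed.

Let gauge0 : gauge V 0 = 0.
Proof.
apply/eqP; rewrite eq_le; apply/andP; split; last first.
  apply: lb_le_inf; first by case: (gset_inf 0).
  by move=> r [/ltW].
apply/ler_addgt0Pr => e e0; rewrite add0r; apply: gauge_le => //.
by rewrite scaler0; exact: nbhs_singleton.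
Qed.

Let gaugeZ_le (a : R) x : gauge V (a *: x) <= `|a| * gauge V x.
Proof.
have [->|a0] := eqVneq a 0; first by rewrite scale0r normr0 mul0r gauge0.
have na0 : 0 < `|a| by rewrite normr_gt0.
apply/ler_addgt0Pr => e e0.
have [r [r0 Vr rx]] := gauge_adh x (divr_gt0 e0 na0).
apply: (@le_trans _ _ (`|a| * r)); last first.
  by rewrite -[e](mulfVK (lt0r_neq0 na0)) [_ * `|a|]mulrC -mulrDr ler_pM2l// ltW.
apply: gauge_le; first exact: mulr_gt0.
rewrite scalerA; have [a_gt0|a_le0] := ltP 0 a.
  by rewrite gtr0_norm// invfM mulrC mulrA divff// mul1r.
rewrite ler0_norm// invfM mulrC mulrA invrN mulrN divff// mulN1r scaleNr.
exact: VN.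
Qed.

Let gaugeZ (a : R) x : gauge V (a *: x) = `|a| * gauge V x.
Proof.
have [->|a0] := eqVneq a 0; first by rewrite scale0r normr0 mul0r gauge0.
apply/eqP; rewrite eq_le gaugeZ_le /=.
rewrite -ler_pdivlMl ?normr_gt0// -normfV.
by rewrite -{1}[x](scalerK a0) gaugeZ_le.
Qed.

Lemma cseminorm_gauge : cseminorm (gauge V).
Proof.
split=> // e e0.
have e20 : 0 < e / 2 by rewrite divr_gt0.
have := nbhs0Z (lt0r_neq0 e20) V0; apply: filterS => _ [x Vx <-] /=.
apply: (@le_lt_trans _ _ (e / 2)); last by rewrite ltr_pdivrMr// ltr_pMr// ltr1n.
by apply: gauge_le => //; rewrite scalerK// lt0r_neq0.
Qed.

Lemma gauge_lt1 x : gauge V x < 1 -> V x.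
Proof.
move=> x1; have x0 : 0 < 1 - gauge V x by rewrite subr_gt0.
have [r [r0 Vr]] := gauge_adh x x0; rewrite addrC subrK => r1.
have := @Vconv _ _ r Vr (nbhs_singleton V0).
rewrite scaler0 addr0 scalerA divff ?lt0r_neq0// scale1r; apply.
by rewrite !ltW.
Qed.

End Gauge.

(** Local convexity supplies a convex neighbourhood [b] that may fail to be symmetric; the gauge is
    taken of its intersection with [- b]. *)
Lemma cseminorm_nbhs (U : set E) : nbhs 0 U ->
  exists2 p, cseminorm p & forall x, p x < 1 -> U x.
Proof.
move=> U0; have [B Bc [Bo Bn]] := @locally_convex R E.
have [b [Bb b0] bU] := Bn 0 U U0.
have nb : nbhs 0 b by apply: open_nbhs_nbhs; split=> //; exact: Bo.
have bc x y (l : R) : b x -> b y -> 0 <= l <= 1 -> b (l *: x + (1 - l) *: y).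
  move=> bx by_ /andP[l0 l1].
  have := Bc b; rewrite inE => /(_ Bb x y).
  move=> /(_ (Itv01 l0 l1)); rewrite !inE => /(_ bx by_).
  exact: id.
pose V := b `&` [set x | b (- x)].
have V0 : nbhs 0 V.
  apply: filterI => //.
  by have := nbhs0N nb; apply: filterS => _ [y yb <-]; rewrite /= opprK.
exists (gauge V).
  apply: cseminorm_gauge => // [x [bx bNx]|x y l [bx bNx] [by_ bNy] l01].
    by split=> //=; rewrite opprK.
  split; first exact: bc.
  by rewrite /= opprD -!scalerN; exact: bc.
move=> x x1; apply: bU; have [] // : V x.
apply: gauge_lt1 x1 => // u v l [bx bNx] [by_ bNy] l01.
split; first exact: bc.
by rewrite /= opprD -!scalerN; exact: bc.
Qed.

Lemma cseminorm_cvg (T : Type) (F : set_system T) (FF : Filter F)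
    (f : T -> E) (l : E) :
  (forall p (e : R), cseminorm p -> 0 < e -> \forall x \near F, p (f x - l) < e) ->
  f @ F --> l.
Proof.
move=> H U Ul.
have U0 : nbhs 0 [set x | U (l + x)].
  have := nbhsB (- l) Ul; rewrite addNr.
  by apply: filterS => _ [y Uy <-] /=; rewrite addNKr.
have [p hp pU] := cseminorm_nbhs U0.
have := H p 1 hp ltr01; apply: filterS => x /pU /=.
by rewrite addrC subrK.
Qed.

Lemma cseminorm_eq (x y : E) : hausdorff_space E ->
  (forall p, cseminorm p -> p (x - y) = 0) -> x = y.
Proof.
move=> hE H; apply: (@cvg_unique E hE ((fun _ : nat => x) @ \oo)).
  exact: cvg_cst.
apply: cseminorm_cvg => p e hp e0; apply: nearW => _; by rewrite H.
Qed.

(** Continuous induction: the set of endpoints up to which the bound holds contains its supremum,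
    and beyond a supremum smaller than [b] it could be extended by [d / 2]. This argument serves
    vector values, where no intermediate point with equality need exist. *)
Lemma lipschitz_local_global (c : R -> E) p (K a b : R) :
  cseminorm p -> a <= b ->
  (forall t, a <= t <= b -> exists2 d : R, 0 < d & forall s, `|s - t| < d ->
     p (c s - c t) <= K * `|s - t|) ->
  p (c b - c a) <= K * (b - a).
Proof.
move=> hp ab H.
pose S := [set t | a <= t <= b /\ p (c t - c a) <= K * (t - a)].
have Sa : S a by rewrite /S /= lexx ab !subrr mulr0 cseminorm0.
have hS : has_sup S by split; [exists a|exists b => t [/andP[]]].
have supab : a <= sup S <= b.
  rewrite ub_le_sup//=; last by case: hS.
  by apply: ge_sup; [exists a|move=> t [/andP[]]].
have [d d0 Hd] := H _ supab.
have Ssup : S (sup S).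
  split=> //; have [s Ss sd] := sup_adherent d0 hS.
  have ss : s <= sup S by apply: ub_le_sup => //; case: hS.
  have sd' : `|s - sup S| < d by rewrite distrC ger0_norm ?subr_ge0//; lra.
  have := Hd s sd'; rewrite distrC ger0_norm ?subr_ge0// => H1.
  have := cseminorm_distl (c (sup S)) (c s) (c a) hp.
  have := Ss.2; rewrite -[c (sup S) - c s]opprB cseminormN//; lra.
have [->|sb] := eqVneq b (sup S); first exact: Ssup.2.
have sb' : sup S < b by rewrite lt_neqAle eq_sym sb; case/andP: supab.
pose t := Order.min b (sup S + d / 2).
have d20 : 0 < d / 2 by rewrite divr_gt0.
have st : sup S < t by rewrite /t lt_min sb' ltrDl.
have td : t <= sup S + d / 2 by rewrite ge_min lexx orbT.
have tb : t <= b by rewrite ge_min lexx.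
have St : S t.
  split; first by rewrite tb andbT (le_trans _ (ltW st))//; case/andP: supab.
  have td' : `|t - sup S| < d by rewrite ger0_norm ?subr_ge0 ?(ltW st)//; lra.
  have := Hd t td'; rewrite ger0_norm ?subr_ge0 ?(ltW st)// => H1.
  have := cseminorm_distl (c t) (c (sup S)) (c a) hp.
  have := Ssup.2; lra.
have : t <= sup S by apply: ub_le_sup => //; case: hS.
by rewrite leNgt st.
Qed.

Lemma cseminorm_mvt (c c' : R -> E) p (M a b : R) :
  cseminorm p -> a <= b ->
  (forall t, a <= t <= b -> is_curve_derive c t (c' t) /\ p (c' t) <= M) ->
  p (c b - c a) <= M * (b - a).
Proof.
move=> hp ab H.
(* A derivative bounded by [M] gives only the local constant [M + e]; [e] tends to 0 at the end. *)
have HK e : 0 < e -> p (c b - c a) <= (M + e) * (b - a).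
  move=> e0; apply: (@lipschitz_local_global c p (M + e) a b) => // t /H [].
  move=> /is_curve_deriveP[q [qv q0 qE]] pM.
  have [d d0 Hd] := (near_realP _ _).1 (cvg_cseminorm _ hp e0 qv).
  exists d => // s sd; have := qE (s - t); rewrite subrK => ->.
  rewrite addrC addKr cseminormZ// mulrC ler_wpM2r//.
  rewrite (le_trans (cseminorm_le _ (c' t) hp))// lerD// ltW//.
  by apply: Hd; rewrite subr0.
have [->|ab'] := eqVneq a b; first by rewrite !subrr mulr0 cseminorm0.
have ba0 : 0 < b - a by rewrite subr_gt0 lt_neqAle ab'.
apply/ler_addgt0Pr => e e0.
by have := HK _ (divr_gt0 e0 ba0); rewrite mulrDl divfK// lt0r_neq0.
Qed.

Lemma cseminorm_mvt0 (c c' : R -> E) p (M s : R) :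
  cseminorm p ->
  (forall t, `|t| <= `|s| -> is_curve_derive c t (c' t) /\ p (c' t) <= M) ->
  p (c s - c 0) <= M * `|s|.
Proof.
move=> hp H; have [s0|s0] := leP 0 s.
  rewrite ger0_norm// -{2}[s]subr0; apply: (@cseminorm_mvt c c') => // t /andP[t0 ts].
  by apply: H; rewrite !ger0_norm.
rewrite ltr0_norm// -[- s]sub0r -[c s - c 0]opprB cseminormN//.
apply: (@cseminorm_mvt c c') => //; first exact: ltW.
move=> t /andP[ts t0]; apply: H.
by rewrite ler0_norm// ltr0_norm// lerN2.
Qed.

End Seminorms.

Lemma cseminorm_abs (R : realType) : cseminorm (fun x : R^o => `|x| : R).
Proof.
split=> [x y|r x|e e0]; first exact: ler_normD.
  by rewrite normrM.
apply/(@nbhs_ballP R R^o); exists e => //= x.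
by rewrite /ball /= sub0r normrN.
Qed.

(** * Smooth curves assembled from rapidly decreasing blocks *)

Section BlockSums.
Variable R : realType.

Lemma is_curve_derive0_seminorm (E : tvsType R) (c : R -> E) (t : R) :
  c t = 0 ->
  (forall p : E -> R, cseminorm p -> exists C d : R, 0 < d /\
     forall h, `|h| < d -> p (c (h + t)) <= C * h ^+ 2) ->
  is_curve_derive c t 0.
Proof.
move=> ct H; apply: cseminorm_cvg => p e hp e0; have [C [d [d0 HC]]] := H p hp.
have C0 : 0 < `|C| + 1 by rewrite ltr_pwDr.
apply: nbhs_dnbhs; apply/near_realP; exists (Order.min d (e / (`|C| + 1))).
  by rewrite lt_min d0 divr_gt0.
move=> h; rewrite subr0 lt_min => /andP[hd]; rewrite ltr_pdivlMr// => he.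
rewrite ct !subr0 (cseminormZ _ _ hp) normfV.
have [->|h0] := eqVneq h 0; first by rewrite normr0 invr0 mul0r.
have nh : 0 < `|h| by rewrite normr_gt0.
rewrite ltr_pdivrMl// (le_lt_trans (HC h hd))//.
rewrite -[h ^+ 2]ger0_norm ?sqr_ge0// normrX expr2 mulrCA ltr_pM2l//.
rewrite mulrC (le_lt_trans _ he)// ler_pM2l// (le_trans (ler_norm _))// lerDl.
exact: ler01.
Qed.

(** Von Neumann boundedness; by the next two lemmas it means that every continuous seminorm is
    bounded above on [B]. *)
Definition bounded_in (E : tvsType R) (B : set E) : Prop :=
  forall U : set E, nbhs 0 U ->
  exists2 r : R, 0 < r & forall s : R, `|s| <= r -> forall y, B y -> U (s *: y).

Lemma bounded_in_seminorm (E : tvsType R) (B : set E) (p : E -> R) :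
  bounded_in B -> cseminorm p -> exists2 C, 0 < C & forall y, B y -> p y <= C.
Proof.
move=> bB hp; have [_ _ /(_ 1 ltr01) pU] := hp.
have [r r0 Hr] := bB _ pU; exists r^-1; first by rewrite invr_gt0.
move=> y By; have : p (r *: y) < 1 by apply: Hr => //; rewrite ger0_norm// ltW.
by rewrite cseminormZ// (ger0_norm (ltW r0)) -ltr_pdivlMl// mulr1 => /ltW.
Qed.

Lemma seminorm_bounded_in (E : tvsType R) (B : set E) :
  (forall p : E -> R, cseminorm p -> exists C, forall y, B y -> p y <= C) ->
  bounded_in B.
Proof.
move=> H U /cseminorm_nbhs [p hp pU]; have [C HC] := H p hp.
have C0 : 0 < `|C| + 1 by rewrite ltr_pwDr.
exists (2 * (`|C| + 1))^-1; first by rewrite invr_gt0 mulr_gt0.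
move=> s; rewrite -[X in _ <= X]mul1r ler_pdivlMr ?mulr_gt0// => sC y By.
apply: pU; rewrite (cseminormZ _ _ hp).
have : `|s| * p y <= `|s| * (`|C| + 1).
  by rewrite ler_wpM2l// (le_trans (HC y By))// (le_trans (ler_norm _))// lerDl.
lra.
Qed.

Lemma bounded_in1 (E : tvsType R) (x : E) : bounded_in [set x].
Proof. by apply: seminorm_bounded_in => p hp; exists (p x) => _ ->. Qed.

Lemma bounded_inU (E : tvsType R) (A B : set E) :
  bounded_in A -> bounded_in B -> bounded_in (A `|` B).
Proof.
move=> bA bB; apply: seminorm_bounded_in => p hp.
have [C _ HC] := bounded_in_seminorm bA hp; have [D _ HD] := bounded_in_seminorm bB hp.
by exists (Order.max C D) => y [/HC|/HD] h; rewrite le_max h ?orbT.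
Qed.

(** Each differentiation of block [n] costs a factor [4 * 4 ^+ n], so decay faster than all powers
    of [4 ^+ n] is the condition that survives every derivative. *)
Definition fast (al : nat -> R) : Prop :=
  forall j : nat, exists C : R, forall n, `|al n| * 4 ^+ (j * n) <= C.

Lemma fast_scale (al : nat -> R) : fast al -> fast (fun n => 4 * 4 ^+ n * al n).
Proof.
move=> fal j; have [C HC] := fal j.+1; exists (4 * C) => n.
rewrite !normrM [`|4|]ger0_norm// [`|4 ^+ n|]ger0_norm ?exprn_ge0//.
rewrite (_ : _ * _ = 4 * (`|al n| * 4 ^+ (j.+1 * n))) ?ler_pM2l//.
by rewrite mulSn exprD; ring.
Qed.

Lemma fast_le (al be : nat -> R) :
  fast al -> (forall n, `|be n| <= `|al n|) -> fast be.
Proof.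
move=> fal ab j; have [C HC] := fal j; exists C => n.
by rewrite (le_trans _ (HC n))// ler_wpM2r// exprn_ge0.
Qed.

(** This is 2 j n <= j^2 + n^2 in the exponent of 2. *)
Lemma fast_sqr : fast (fun n => (2 ^+ (n ^ 2))^-1).
Proof.
move=> j; exists (2 ^+ (j ^ 2)) => n.
rewrite ger0_norm ?invr_ge0 ?exprn_ge0// mulrC ler_pdivrMr ?exprn_gt0//.
rewrite -exprD (_ : 4 = 2 ^+ 2 :> R); last by rewrite expr2 -natrM.
rewrite -exprM ler_eXn2l ?ltr1n//; by case: (nat_Cauchy j n).
Qed.

(** No sign is prescribed, so that derivatives of bumps are bumps. *)
Definition bump (psi : R -> R^o) : Prop :=
  smooth_curve setT psi /\ forall u, 1 < `|u| -> psi u = 0.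

Lemma bump_derive psi : bump psi -> bump (curve_derive psi).
Proof.
move=> [spsi psi0]; split; first exact: smooth_curve_derive.
move=> u u1; apply: curve_deriveE => //.
apply: (@near_is_curve_derive _ _ (fun=> 0)); last exact: is_curve_derive_cst.
apply/near_realP; exists (`|u| - 1); first by rewrite subr_gt0.
move=> s su; rewrite psi0//; have := ler_normD (u - s) s.
by rewrite subrK distrC; lra.
Qed.

Lemma bump_bounded psi : bump psi -> exists2 K, 0 < K & forall u, `|psi u| <= K.
Proof.
move=> [spsi psi0].
have c : {within `[-1, 1]%classic, continuous (fun u : R => `|psi u| : R)}.
  apply: continuous_subspaceT => u; apply: cvg_norm.
  exact: (smooth_curve_continuous spsi).
have [u0 _ Hu] := EVT_max (ltW (lt_trans (ltrN10 R) ltr01)) c.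
exists (`|psi u0| + 1); first by rewrite ltr_pwDr.
move=> u; have [u1|u1] := leP `|u| 1.
  have ui : u \in `[-1, 1] by rewrite in_itv /= -ler_norml.
  by rewrite (le_trans (Hu _ ui))// lerDl.
by rewrite psi0// normr0 addr_ge0.
Qed.

(* Block [n] lives where [4 ^ n * t] is within 1/4 of 1; these windows are disjoint. *)
Definition phase (n : nat) (t : R) : R := - 4 + t * (4 * 4 ^+ n).

Section Block.
Variable E : tvsType R.
Implicit Types (psi : R -> R^o) (al : nat -> R) (y : nat -> E).

Definition block_term psi al y (n : nat) (t : R) : E :=
  psi (phase n t) *: (al n *: y n).

(** The series over all [n], as a finite sum: for [n > 2 / t > 0] one has [4 ^+ n * t > 2], outside
    window [n], and for [t <= 0] every term vanishes when [psi] is a bump. *)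
Definition block psi al y (t : R) : E :=
  \sum_(n < (Num.truncn (2 / t)).+1) block_term psi al y n t.

Lemma phase_window n t : `|phase n t| <= 1 ->
  [/\ 0 < t, 3 / 4 <= 4 ^+ n * t & 4 ^+ n * t <= 5 / 4].
Proof.
rewrite /phase ler_norml => /andP[h1 h2].
have p0 : 0 < 4 ^+ n :> R by rewrite exprn_gt0.
have a : 3 / 4 <= 4 ^+ n * t by lra.
split=> //; last by lra.
by rewrite -(pmulr_rgt0 _ p0); lra.
Qed.

Lemma block_term_neq0 psi al y n t : bump psi -> block_term psi al y n t != 0 ->
  `|phase n t| <= 1.
Proof.
move=> [_ psi0]; rewrite /block_term; case: leP => // /psi0 ->.
by rewrite scale0r eqxx.
Qed.

Lemma ltn_pow4 n : n%:R < 4 ^+ n :> R.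
Proof. by rewrite -natrX ltr_nat ltn_expl. Qed.

Lemma sum_ord_tail0 (F : nat -> E) (M N : nat) :
  (forall n, (M <= n)%N -> F n = 0) -> (forall n, (N <= n)%N -> F n = 0) ->
  \sum_(n < M) F n = \sum_(n < N) F n.
Proof.
wlog MN : M N / (M <= N)%N => [H FM FN|FM _].
  by case: (leqP M N) => [|/ltnW] MN; [|symmetry]; exact: H.
rewrite -(subnKC MN) big_split_ord /= [X in _ + X]big1 ?addr0// => i _.
by apply: FM; rewrite leq_addr.
Qed.

Lemma block_trunc psi al y t (M : nat) : bump psi ->
  (forall n, (M <= n)%N -> block_term psi al y n t = 0) ->
  block psi al y t = \sum_(n < M) block_term psi al y n t.
Proof.
move=> bpsi H; apply: (@sum_ord_tail0 (fun n => block_term psi al y n t)) => // n.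
move=> nN; apply/eqP; apply: contraTT isT => /(block_term_neq0 bpsi)/phase_window.
move=> [t0 _ nt].
have : 2 / t < n%:R.
  by rewrite (lt_le_trans (truncnS_gt _))// ler_nat.
by rewrite ltr_pdivrMr//; have := ltn_pow4 n; rewrite -(ltr_pM2r t0); lra.
Qed.

Lemma block_le0 psi al y t : bump psi -> t <= 0 -> block psi al y t = 0.
Proof.
move=> bpsi t0; rewrite (@block_trunc _ _ _ _ 0)// ?big_ord0// => n _.
apply/eqP; apply: contraTT isT => /(block_term_neq0 bpsi)/phase_window[].
by rewrite ltNge t0.
Qed.

Lemma block_window psi al y n t : bump psi -> `|phase n t| <= 1 ->
  block psi al y t = block_term psi al y n t.
Proof.
move=> bpsi /phase_window [t0 n1 n2].
have H m : m <> n -> block_term psi al y m t = 0.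
  move=> mn; apply/eqP; apply: contraTT isT => /(block_term_neq0 bpsi)/phase_window.
  move=> [_ m1 m2]; have : (m < n)%N || (n < m)%N by rewrite -neq_ltn; exact/eqP.
  (* Two windows would force a ratio of at least 4 between numbers of [3/4, 5/4]. *)
  have X a b : (a < b)%N -> 4 ^+ a * t * 4 <= 4 ^+ b * t :> R.
    move=> ab; rewrite mulrAC -exprSr ler_pM2r// ler_eXn2l// ltr1n//.
  by move=> /orP[/X|/X]; lra.
rewrite (@block_trunc _ _ _ _ n.+1)// => [|m nm]; last first.
  by apply: H => mn; rewrite mn ltnn in nm.
rewrite big_ord_recr /= big1 ?add0r// => i _.
by apply: H => mn; have := ltn_ord i; rewrite mn ltnn.
Qed.

Lemma is_curve_derive_phase n t : is_curve_derive (phase n : R -> R^o) t (4 * 4 ^+ n).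
Proof. exact: is_curve_derive_line. Qed.

Lemma is_curve_derive_block_term psi al y n t : bump psi ->
  is_curve_derive (block_term psi al y n) t
    (block_term (curve_derive psi) (fun n => 4 * 4 ^+ n * al n) y n t).
Proof.
move=> [spsi _].
have := is_curve_deriveZ (is_curve_derive_comp (@is_curve_derive_phase n t)
  (smooth_curve_deriveP spsi I)) (is_curve_derive_cst (al n *: y n) t).
rewrite scaler0 addr0 /block_term; congr is_curve_derive.
by rewrite !scalerA /GRing.scale /=; congr (_ *: _); ring.
Qed.

Lemma geometric4_le (N : nat) : \sum_(n < N) (4 ^+ n)^-1 <= 2 :> R.
Proof.
(* The subtracted remainder makes the bound inductive. *)
suff : \sum_(n < N) (4 ^+ n)^-1 <= 2 - 2 * (4 ^+ N)^-1 :> R.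
  move=> /le_trans; apply; rewrite gerBl mulr_ge0// invr_ge0 exprn_ge0//.
elim: N => [|N IHN]; first by rewrite big_ord0 expr0 invr1; lra.
rewrite big_ord_recr /= exprS invfM; have : 0 <= (4 ^+ N)^-1 :> R.
  by rewrite invr_ge0 exprn_ge0.
move: IHN; lra.
Qed.

(** Flatness at 0. The decay of [al] is used with three powers of [(4 ^+ n)^-1]: on window [n] two
    of them are at most [(4 / 3 * h) ^+ 2 <= 2 * h ^+ 2], and the third sums to at most 2. *)
Lemma block_le_sqr psi al y p : bump psi -> fast al -> bounded_in (range y) ->
  cseminorm p -> exists C, forall h, p (block psi al y h) <= C * h ^+ 2.
Proof.
move=> bpsi fal by_ hp; have [K K0 HK] := bump_bounded bpsi.
have [C C0 HC] := bounded_in_seminorm by_ hp.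
have [A HA] := fal 3%N.
have A0 : 0 <= A by apply: le_trans (HA 0); rewrite mulr_ge0// exprn_ge0.
exists (K * C * A * 2 * 2) => h.
have [h0|h0] := leP h 0.
  by rewrite block_le0// cseminorm0// mulr_ge0 ?sqr_ge0// !mulr_ge0 ?(ltW K0) ?(ltW C0).
apply: (@le_trans _ _ (\sum_(n < (Num.truncn (2 / h)).+1)
    p (block_term psi al y n h))).
  rewrite /block; elim/big_ind2: _ => [|u u' v v' uu vv|//].
    by rewrite cseminorm0.
  by rewrite (le_trans (cseminormD _ _ hp))// lerD.
apply: (@le_trans _ _ (\sum_(n < (Num.truncn (2 / h)).+1)
    K * C * A * 2 * h ^+ 2 * (4 ^+ n)^-1)); last first.
  rewrite -mulr_sumr [X in _ <= X]mulrAC ler_wpM2l ?geometric4_le//.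
  by rewrite mulr_ge0 ?sqr_ge0// !mulr_ge0 ?(ltW K0) ?(ltW C0).
apply: ler_sum => n _.
have q0 : 0 < (4 ^+ n)^-1 :> R by rewrite invr_gt0 exprn_gt0.
have [->|/(block_term_neq0 bpsi)/phase_window[_ n1 n2]] :=
    eqVneq (block_term psi al y n h) 0.
  rewrite cseminorm0// mulr_ge0 ?(ltW q0)// mulr_ge0 ?sqr_ge0//.
  by rewrite !mulr_ge0 ?(ltW K0) ?(ltW C0).
rewrite /block_term !(cseminormZ _ _ hp).
have p1 : p (y n) <= C by apply: HC; exists n.
have a1 : `|al n| <= A * (4 ^+ n)^-1 ^+ 3.
  by rewrite exprVn -exprM mulnC ler_pdivlMr ?exprn_gt0.
have hn : (4 ^+ n)^-1 <= 4 / 3 * h.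
  by rewrite -[X in X <= _]mul1r ler_pdivrMr ?exprn_gt0//; lra.
have h2 : (4 ^+ n)^-1 ^+ 2 <= 2 * h ^+ 2.
  apply: (@le_trans _ _ ((4 / 3 * h) ^+ 2)).
    by apply: lerXn2r => //; rewrite nnegrE ?mulr_ge0// ltW.
  by rewrite exprMn ler_wpM2r ?sqr_ge0//; lra.
apply: (@le_trans _ _ (K * (A * (4 ^+ n)^-1 ^+ 3 * C))).
  apply: ler_pM => //; first by rewrite mulr_ge0// cseminorm_ge0.
  by apply: ler_pM => //; exact: cseminorm_ge0.
rewrite [X in _ <= X](_ : _ = K * (A * (2 * h ^+ 2 * (4 ^+ n)^-1) * C)); last by ring.
rewrite ler_wpM2l ?(ltW K0)// ler_wpM2r ?(ltW C0)// ler_wpM2l//.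
by rewrite exprSr ler_wpM2r// ltW.
Qed.

Lemma is_curve_derive_sum (N : nat) (c d : nat -> R -> E) (t : R) :
  (forall n, is_curve_derive (c n) t (d n t)) ->
  is_curve_derive (fun s => \sum_(n < N) c n s) t (\sum_(n < N) d n t).
Proof.
move=> cd; elim: N => [|N IHN].
  rewrite big_ord0 (_ : (fun s => _) = fun=> 0); first exact: is_curve_derive_cst.
  by apply/funext => s; rewrite big_ord0.
rewrite big_ord_recr /= (_ : (fun s => _) = (fun s => \sum_(n < N) c n s + c N s)).
  exact: is_curve_deriveD.
by apply/funext => s; rewrite big_ord_recr.
Qed.

Lemma is_curve_derive_block psi al y t :
  bump psi -> fast al -> bounded_in (range y) ->
  is_curve_derive (block psi al y) t
    (block (curve_derive psi) (fun n => 4 * 4 ^+ n * al n) y t).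
Proof.
move=> bpsi fal by_; have bpsi' := bump_derive bpsi.
have [t0|t0|->] := ltgtP t 0.
- rewrite block_le0 ?ltW//.
  apply: (@near_is_curve_derive _ _ (fun=> 0)); last exact: is_curve_derive_cst.
  apply: (@open_near R [set s | s < 0]) => //.
  by move=> s /= s0; rewrite block_le0// ltW.
(* The truncation index attached to [t / 2] is valid for all [s > t / 2], which makes the sum finite
   uniformly near [t]. *)
- have t20 : 0 < t / 2 by rewrite divr_gt0.
  have H (psi0 : R -> R^o) (al0 : nat -> R) s n : bump psi0 -> t / 2 < s ->
      ((Num.truncn (2 / (t / 2))).+1 <= n)%N -> block_term psi0 al0 y n s = 0.
    move=> b0 ts nN; apply/eqP; apply: contraTT isT.
    move=> /(block_term_neq0 b0)/phase_window [s0 _ ns].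
    have : 2 / (t / 2) < n%:R.
      by rewrite (lt_le_trans (truncnS_gt _))// ler_nat.
    rewrite ltr_pdivrMr// => h1; have := ltn_pow4 n; rewrite -(ltr_pM2r s0) => h2.
    have : n%:R * (t / 2) <= n%:R * s :> R by rewrite ler_wpM2l// ltW.
    by lra.
  rewrite (@block_trunc _ _ _ t (Num.truncn (2 / (t / 2))).+1)//; last first.
    by move=> n; apply: H => //; lra.
  apply: (@near_is_curve_derive _ _ (fun s => \sum_(n < (Num.truncn (2 / (t / 2))).+1)
      block_term psi al y n s)).
    apply: (@open_near R [set s | t / 2 < s]) => //=; first by lra.
    by move=> s /= ts; rewrite (@block_trunc _ _ _ s (Num.truncn (2 / (t / 2))).+1)// => n; exact: H.
  apply: (@is_curve_derive_sum _ (block_term psi al y)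
    (block_term (curve_derive psi) (fun n => 4 * 4 ^+ n * al n) y)) => n.
  exact: is_curve_derive_block_term.
- rewrite block_le0//.
  apply: is_curve_derive0_seminorm; first exact: block_le0.
  move=> p hp; have [C HC] := block_le_sqr bpsi fal by_ hp.
  by exists C, 1; split=> // h _; rewrite addr0.
Qed.

(** Differentiating a block sum gives a block sum over the same [y], with [psi] replaced by its
    derivative and the amplitudes still [fast]. *)
Lemma smooth_curve_block psi al y : hausdorff_space E ->
  bump psi -> fast al -> bounded_in (range y) -> smooth_curve setT (block psi al y).
Proof.
move=> hE bpsi fal by_; apply: (@smooth_curve_coind R E setT (fun u =>
  exists psi al, [/\ bump psi, fast al & u = block psi al y])) => //.
- move=> _ [psi0 [al0 [b0 f0 ->]]].
  exists (block (curve_derive psi0) (fun n => 4 * 4 ^+ n * al0 n) y).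
    exists (curve_derive psi0), (fun n => 4 * 4 ^+ n * al0 n).
    by split=> //; [exact: bump_derive|exact: fast_scale].
  by move=> t _; exact: is_curve_derive_block.
- by exists psi, al.
Qed.

End Block.
End BlockSums.

(** * Uniform bounds on iterated directional derivatives of smooth maps *)

Section SmoothMaps.
Variable R : realType.

(** The identity near 0, cut off: it makes a block run along a line at constant speed. *)
Definition cut_id (u : R) : R^o := u * plateau u.

Lemma bump_plateau : bump (@plateau R).
Proof. by split; [exact: smooth_plateau|exact: plateau0]. Qed.

Lemma bump_cut_id : bump cut_id.
Proof.
split=> [|u u1]; last by rewrite /cut_id plateau0// mulr0.
apply: (@smooth_curveZ R R^o) => //; last exact: smooth_plateau.
exact: smooth_curve_id.
Qed.

Lemma cut_id_le1 u : `|cut_id u| <= 1.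
Proof.
rewrite /cut_id; have [u1|u1] := leP `|u| 1.
  by rewrite normrM mulr_ile1// plateau_ge0_le1.
by rewrite plateau0// mulr0 normr0.
Qed.

Lemma cut_idE u : `|u| <= 2^-1 -> cut_id u = u.
Proof. by move=> u1; rewrite /cut_id plateau1// mulr1. Qed.

Definition retract (t0 r t : R) : R^o := t0 + r * cut_id (- (t0 / r) + t * r^-1).

Lemma smooth_retract t0 r : smooth_curve setT (retract t0 r).
Proof.
apply: (@smooth_curveD R R^o) => //; first exact: smooth_curve_cst.
apply: (@smooth_curveZ R R^o) => //; first exact: smooth_curve_cst.
apply: (@smooth_curve_comp R R^o setT setT) => //; last by case: bump_cut_id.
exact: smooth_curve_line.
Qed.

Lemma retract_le t0 r t : 0 < r -> `|retract t0 r t - t0| <= r.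
Proof.
move=> r0; rewrite /retract addrC addKr normrM gtr0_norm//.
by rewrite ger_pMr// cut_id_le1.
Qed.

Lemma retractE t0 r t : 0 < r -> `|t - t0| <= r / 2 -> retract t0 r t = t.
Proof.
move=> r0 tr; have rn0 : r != 0 by rewrite gt_eqF.
have e : - (t0 / r) + t * r^-1 = (t - t0) / r by rewrite mulrBl addrC.
rewrite /retract e cut_idE; first by rewrite mulrC divfK// addrC subrK.
by rewrite normrM normfV (gtr0_norm r0) ler_pdivrMr// mulrC.
Qed.

Lemma open_ballR (t0 r : R) : open [set s : R | `|s - t0| < r].
Proof.
rewrite (_ : [set _ | _] = ball t0 r); first exact: ball_open.
by apply/seteqP; split=> s /=; rewrite /ball /= distrC.
Qed.

(** [smooth_map] tests only curves defined on the whole line. Around [t0], precomposing [c] with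
    [retract] keeps the parameter inside [I] without changing [c] near [t0], and smoothness is
    local. *)
Lemma smooth_map_curve (E G : tvsType R) (N : set E) (f : E -> G) I (c : R -> E) :
  hausdorff_space E -> open I -> smooth_map N f ->
  smooth_curve I c -> (forall t, I t -> N (c t)) ->
  smooth_curve I (fun t => f (c t)).
Proof.
move=> hE oI sf sc cN; apply: smooth_curve_local => t0 It0.
have [r r0 Hr] := (near_realP t0 I).1 (open_near oI It0 (fun s Is => Is)).
have r20 : 0 < r / 2 by rewrite divr_gt0.
have rI t : I (retract t0 (r / 2) t).
  by apply: Hr; rewrite (le_lt_trans (retract_le _ _ _))//; lra.
exists [set s | `|s - t0| < r / 2 / 2], (f \o (fun t => c (retract t0 (r / 2) t))).
split.
- exact: open_ballR.
- by rewrite /= subrr normr0 divr_gt0.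
- apply: (@smooth_curveW _ _ setT) => //; apply: sf => [|t]; last exact: cN.
  apply: smooth_curve_comp sc => //; exact: smooth_retract.
- by move=> s /= sr; rewrite retractE// ltW.
Qed.

Lemma open_curve_preimage (E : tvsType R) (N : set E) (c : R -> E) :
  open N -> smooth_curve setT c -> open [set t : R | N (c t)].
Proof.
move=> oN sc.
have cc : continuous (c : R^o -> E) by move=> t; exact: smooth_curve_continuous sc I.
exact: (open_comp (fun x _ => cc x) oN).
Qed.

Lemma nbhs_bounded_in (E : tvsType R) (N : set E) (x0 : E) (B : set E) :
  open N -> N x0 -> bounded_in B -> exists2 d : R, 0 < d &
  forall a b y v, `|a| <= d -> `|b| <= d -> B y -> B v ->
    N (x0 + a *: y + b *: v).
Proof.
move=> oN Nx0 bB.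
have U0 : nbhs (0 : E) [set z | N (x0 + z)].
  have := nbhsB (- x0) (open_nbhs_nbhs (conj oN Nx0)); rewrite addNr.
  by apply: filterS => _ [y Uy <-] /=; rewrite addrA subrr add0r.
have [p hp pU] := cseminorm_nbhs U0.
have [C C0 HC] := bounded_in_seminorm bB hp.
exists (C^-1 / 4); first by rewrite divr_gt0// invr_gt0.
move=> a b y v ad bd By Bv; rewrite -addrA; apply: pU.
rewrite (le_lt_trans (cseminormD _ _ hp))// !(cseminormZ _ _ hp).
have X (r : R) z : `|r| <= C^-1 / 4 -> B z -> `|r| * p z <= 4^-1.
  move=> rd Bz; rewrite (le_trans (ler_pM _ _ rd (HC z Bz)))//.
    exact: cseminorm_ge0.
  by rewrite mulrAC mulVf ?mul1r// gt_eqF.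
have := X a y ad By; have := X b v bd Bv; lra.
Qed.

Section DerivativeBound.
Variables (E G : tvsType R) (N : set E) (f : E -> G) (x0 : E) (B : set E).
Hypotheses (hE : hausdorff_space E) (hG : hausdorff_space G).
Hypotheses (oN : open N) (Nx0 : N x0) (sf : smooth_map N f) (bB : bounded_in B).

Lemma smooth_map_line (x v : E) :
  smooth_curve [set s | N (x + s *: v)] (fun s : R => f (x + s *: v)).
Proof.
have sl := @smooth_curve_line R E setT x v hE (@open_setTR R).
apply: smooth_map_curve sf _ _ => //; first exact: open_curve_preimage.
exact: smooth_curveW sl.
Qed.

(* If the bound failed, one could find violating data shrinking like
   2^(-n^2); a smooth curve running through all of it, at speed
   [4 * 4 ^ n * 2^(-n^2)] in block [n], would be mapped by [f] to a curve whose
   [k]-th derivative is unbounded near 0. *)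
Lemma smooth_map_iter_bounded (p : G -> R) (k : nat) : cseminorm p ->
  exists d M : R, 0 < d /\ forall a b y v, `|a| <= d -> `|b| <= d -> B y -> B v ->
    p (iter k (@curve_derive R G) (fun s : R => f (x0 + a *: y + s *: v)) b) <= M.
Proof.
move=> hp; apply: contrapT => H.
have [d0 d00 Nd0] := nbhs_bounded_in oN Nx0 bB.
pose w n : R := (2 ^+ (n ^ 2))^-1.
have w0 n : 0 < w n by rewrite invr_gt0 exprn_gt0.
pose e n : R := 4 * 4 ^+ n * w n.
have e0 n : 0 < e n by rewrite mulr_gt0// mulr_gt0// exprn_gt0.
(* The violated bound is [n%:R / e n ^+ k] because traversing a line at speed [e n] multiplies its
   [k]-th derivative by [e n ^+ k]. *)
have {}H n : exists z : (R * R) * (E * E),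
    [/\ `|z.1.1| <= w n /\ `|z.1.2| <= w n,
        `|z.1.1| <= d0 /\ `|z.1.2| <= d0, B z.2.1 /\ B z.2.2 &
        n%:R / e n ^+ k < p (iter k (@curve_derive R G)
          (fun s : R => f (x0 + z.1.1 *: z.2.1 + s *: z.2.2)) z.1.2)].
  apply: contrapT => Hn; apply: H.
  exists (Order.min (w n) d0), (n%:R / e n ^+ k).
  split; first by rewrite lt_min w0.
  move=> a b y v; rewrite !le_min => /andP[a1 a2] /andP[b1 b2] By Bv.
  by rewrite leNgt; apply/negP => h; apply: Hn; exists ((a, b), (y, v)).
have [z Hz] := choice H; pose a n := (z n).1.1; pose b n := (z n).1.2.
pose y n := (z n).2.1; pose v n := (z n).2.2.
have fw : fast w := @fast_sqr R.
have fa : fast a.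
  by apply: fast_le fw _ => n; rewrite (gtr0_norm (w0 n)); case: (Hz n) => -[].
have fb : fast b.
  by apply: fast_le fw _ => n; rewrite (gtr0_norm (w0 n)); case: (Hz n) => -[].
have bsub (u : nat -> E) : (forall n, B (u n)) -> bounded_in (range u).
  move=> Bu U /bB [r r0 Hr]; exists r => // s sr _ [n _ <-]; exact: Hr.
have by_ : bounded_in (range y) by apply: bsub => n; case: (Hz n) => _ _ [].
have bv : bounded_in (range v) by apply: bsub => n; case: (Hz n) => _ _ [].
(* In the core of window [n] the two plateau sums hold the offsets [a n *: y n] and [b n *: v n]
   fixed, while the [cut_id] sum moves along [v n], crossing the bad point at time [(4 ^+ n)^-1]. *)
pose c t := x0 + block (@plateau R) a y t + block (@plateau R) b v t
  + block cut_id w v t.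
have sc : smooth_curve setT c.
  apply: smooth_curveD => //; last exact: smooth_curve_block bump_cut_id _ _.
  apply: smooth_curveD => //; last exact: smooth_curve_block bump_plateau _ _.
  apply: smooth_curveD => //; last exact: smooth_curve_block bump_plateau _ _.
  exact: smooth_curve_cst.
have c0 : c 0 = x0.
  by rewrite /c !block_le0 ?addr0//; [exact: bump_cut_id|exact: bump_plateau..].
have cE n t : `|phase n t| <= 2^-1 ->
    c t = x0 + a n *: y n + (b n - 4 * w n + t * e n) *: v n.
  move=> tn; have tn1 : `|phase n t| <= 1 by rewrite (le_trans tn)//; lra.
  rewrite /c !(block_window _ _ _ tn1); [|exact: bump_cut_id|exact: bump_plateau..].
  rewrite /block_term plateau1// cut_idE// !scale1r scalerA -!addrA -scalerDl.
  congr (_ + (_ + _ *: _)); rewrite /phase /e; ring.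
have sfc : smooth_curve [set t | N (c t)] (fun t => f (c t)).
  apply: smooth_map_curve sf _ _ => //; first exact: open_curve_preimage.
  exact: smooth_curveW sc.
pose D := iter k (@curve_derive R G) (fun t => f (c t)).
have DE n : D (4 ^+ n)^-1 = e n ^+ k *: iter k (@curve_derive R G)
    (fun s : R => f (x0 + a n *: y n + s *: v n)) (b n).
  have q0 : 0 < 4 ^+ n :> R by rewrite exprn_gt0.
  have tn : (4 ^+ n)^-1 * e n = 4 * w n.
    by rewrite /e mulrA mulrCA mulVf ?mulr1// gt_eqF.
  have Nn : N (x0 + a n *: y n + b n *: v n).
    by case: (Hz n) => _ [a1 b1] [By Bv] _; exact: Nd0.
  have := @iter_curve_derive_affine R G _ _ (b n - 4 * w n) (e n) k (4 ^+ n)^-1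
    hG (open_curve_preimage oN (smooth_curve_line _ _ hE (@open_setTR R)))
    (@smooth_map_line (x0 + a n *: y n) (v n)).
  rewrite tn subrK => <-//.
  (* With this radius [phase n t] stays within 1/2 of 0, where [plateau] is 1 and [cut_id] is the
     identity. *)
  apply: (@iter_curve_derive_eq R G [set t | `|t - (4 ^+ n)^-1| < (8 * 4 ^+ n)^-1]).
  - exact: open_ballR.
  - move=> t /= tn'; rewrite (cE n)//.
    have -> : phase n t = (t - (4 ^+ n)^-1) * (4 * 4 ^+ n).
      by rewrite /phase; field; rewrite gt_eqF.
    rewrite normrM [`|4 * _|]gtr0_norm ?mulr_gt0// -ler_pdivlMr ?mulr_gt0//.
    rewrite (le_trans (ltW tn'))// !invfM mulrA ler_wpM2r ?invr_ge0 ?(ltW q0)//; lra.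
  - by rewrite /= subrr normr0 invr_gt0 mulr_gt0.
have D0 : {for 0, continuous (D : R^o -> G)}.
  by apply: smooth_curve_continuous (smooth_curve_iter k sfc) _; rewrite /= c0.
have [d d_gt0 Hd] := (near_realP _ _).1 (cvg_cseminorm _ hp ltr01 D0).
(* This index puts [(4 ^+ n)^-1] within [d] of 0, where continuity keeps [p] of [D] below
   [p (D 0) + 1], and exceeds that value itself; yet the bad point makes [p] of [D] larger than
   [n]. *)
pose n := (Num.truncn (Order.max (p (D 0) + 1) d^-1)).+1.
have : Order.max (p (D 0) + 1) d^-1 < n%:R by exact: truncnS_gt.
rewrite gt_max => /andP[n1 n2].
have n0 : 0 < n%:R :> R by rewrite ltr0n.
have tnd : (4 ^+ n)^-1 < d.
  rewrite -[d]invrK ltf_pV2 ?posrE ?invr_gt0 ?exprn_gt0//.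
  by rewrite (lt_trans n2)// ltn_pow4.
have h1 : p (D (4 ^+ n)^-1 - D 0) < 1.
  by apply: Hd; rewrite subr0 gtr0_norm ?invr_gt0 ?exprn_gt0.
have h2 := cseminorm_le (D (4 ^+ n)^-1) (D 0) hp.
have h3 : n%:R < p (D (4 ^+ n)^-1).
  rewrite DE cseminormZ// gtr0_norm ?exprn_gt0// mulrC -ltr_pdivrMr ?exprn_gt0//.
  by case: (Hz n).
have : n%:R < n%:R :> R.
  by rewrite (lt_trans h3)// (le_lt_trans h2)// (lt_trans _ n1)// ltrD2l.
by rewrite ltxx.
Qed.

Lemma smooth_map_lipschitz (p : G -> R) : cseminorm p ->
  exists d M : R, 0 < d /\ forall a b y v, `|a| <= d -> `|b| <= d -> B y -> B v ->
    p (f (x0 + a *: y + b *: v) - f (x0 + a *: y)) <= M * `|b|.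
Proof.
move=> hp; have [d0 [M [d00 H]]] := smooth_map_iter_bounded 1 hp.
have [d1 d10 Nd] := nbhs_bounded_in oN Nx0 bB.
exists (Order.min d0 d1), M; split; first by rewrite lt_min d00.
move=> a b y v; rewrite !le_min => /andP[a0 a1] /andP[b0 b1] By Bv.
pose g (s : R) := f (x0 + a *: y + s *: v).
have -> : f (x0 + a *: y) = g 0 by rewrite /g scale0r addr0.
apply: (cseminorm_mvt0 hp (c := g) (c' := curve_derive g)) => t tb.
split; last by apply: H => //; rewrite (le_trans tb).
apply: smooth_curve_deriveP (@smooth_map_line (x0 + a *: y) v) _.
by apply: Nd => //; exact: le_trans b1.
Qed.

(** The bound on second derivatives, integrated twice by the mean value inequality. That one [M]
    serves all [a] and all directions allows expansions at different base points to be compared. *)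
Lemma smooth_map_taylor2 (p : G -> R) : cseminorm p ->
  exists d M : R, 0 < d /\ forall a b y v, `|a| <= d -> `|b| <= d -> B y -> B v ->
    p (f (x0 + a *: y + b *: v) - f (x0 + a *: y) -
       b *: differential f (x0 + a *: y) v) <= M * b ^+ 2.
Proof.
move=> hp; have [d0 [M [d00 H]]] := smooth_map_iter_bounded 2 hp.
have [d1 d10 Nd] := nbhs_bounded_in oN Nx0 bB.
exists (Order.min d0 d1), M; split; first by rewrite lt_min d00.
move=> a b y v; rewrite !le_min => /andP[a0 a1] /andP[b0 b1] By Bv.
pose g (s : R) := f (x0 + a *: y + s *: v).
have sg : smooth_curve [set s | N (x0 + a *: y + s *: v)] g by exact: smooth_map_line.
have gN s : `|s| <= `|b| -> N (x0 + a *: y + s *: v).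
  by move=> sb; apply: Nd => //; exact: le_trans b1.
have M1 s : `|s| <= `|b| -> p (curve_derive g s - curve_derive g 0) <= M * `|s|.
  move=> sb; apply: (cseminorm_mvt0 hp (c' := curve_derive (curve_derive g))) => t ts.
  split; last by apply: H => //; rewrite (le_trans ts)// (le_trans sb).
  apply: smooth_curve_deriveP (smooth_curve_derive sg) _.
  by apply: gN; exact: le_trans sb.
pose h (s : R) := g s + (- s) *: curve_derive g 0.
have -> : f (x0 + a *: y + b *: v) - f (x0 + a *: y) -
    b *: differential f (x0 + a *: y) v = h b - h 0.
  by rewrite /h /g oppr0 !scale0r !addr0 scaleNr addrAC.
have := @cseminorm_mvt0 R G h (fun s => curve_derive g s - curve_derive g 0)
  p (M * `|b|) b hp.
rewrite -mulrA -expr2 real_normK ?num_real//; apply=> t tb; split.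
  apply: is_curve_deriveD; first exact: smooth_curve_deriveP sg (gN t tb).
  have dN : is_curve_derive (fun s : R => - s : R^o) t (-1).
    have := @is_curve_derive_line R R^o 0 (-1) t; congr is_curve_derive.
    by apply/funext => s; rewrite add0r /GRing.scale /= mulrN1.
  have := is_curve_deriveZ dN (is_curve_derive_cst (curve_derive g 0) t).
  by rewrite scaler0 addr0 scaleN1r.
rewrite (le_trans (M1 t tb))// ler_wpM2l//.
apply: le_trans (H 0 0 y v _ _ By Bv); rewrite ?normr0 ?(ltW d00)//.
exact: cseminorm_ge0.
Qed.

End DerivativeBound.
End SmoothMaps.

(** * Linearity of the differential and the chain rule *)

Section Differentials.
Variables (R : realType) (E G : tvsType R) (N : set E) (f : E -> G).
Hypotheses (hE : hausdorff_space E) (hG : hausdorff_space G).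
Hypotheses (oN : open N) (sf : smooth_map N f).

Lemma is_curve_derive_differential (x v : E) : N x ->
  is_curve_derive (fun s : R => f (x + s *: v)) 0 (differential f x v).
Proof.
move=> Nx; apply: smooth_curve_deriveP (smooth_map_line hE oN sf (x := x) (v := v)) _.
by rewrite /= scale0r addr0.
Qed.

Lemma differentialZ (x v : E) (r : R) : N x ->
  differential f x (r *: v) = r *: differential f x v.
Proof.
move=> Nx; apply: curve_deriveE => //.
have := @is_curve_derive_differential x v Nx; rewrite -[X in is_curve_derive _ X](mul0r r).
rewrite -[X in is_curve_derive _ X]add0r => /is_curve_derive_affine.
congr is_curve_derive; apply/funext => s.
by rewrite add0r scalerA.
Qed.

(** First order expansions along the sides of a triangle with values [B], [C], [A]: the values
    cancel and only the three remainders are left. *)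
Lemma second_difference_aux (A B C e1 e3 e4 : G) :
  e1 - e3 - e4 = (A - C - e4) - (A - B - e1) + (C - B - e3).
Proof.
have -> : A - B = A - C + (C - B) by rewrite addrA subrK.
rewrite opprB [A - C - e4]addrC addrACA -[- e4 + _ + _]addrA.
by rewrite [e1 - _ - e3]addrAC addrACA subrr addr0 addrC.
Qed.

(* The second differences [f (y + u) + f (y - u) - 2 f y] at [y = x + s m] are
   quadratically small, which forces the first order terms to be additive. *)
Lemma differential_midpoint (x m u : E) : N x ->
  differential f x (m + u) + differential f x (m - u) = 2 *: differential f x m.
Proof.
move=> Nx; apply: cseminorm_eq => // p hp.
pose B : set E := [set m] `|` [set u] `|` [set m + u] `|` [set m - u].
have bB : bounded_in B.
  by do 3 (apply: bounded_inU; last exact: bounded_in1); exact: bounded_in1.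
have [d [M [d0 H]]] := smooth_map_taylor2 hE hG oN Nx sf bB hp.
have Bm : B m by left; left; left.
have Bu : B u by left; left; right.
have Bp : B (m + u) by left; right.
have Bn : B (m - u) by right.
(* Each of the triangles through [m + u] and [m - u] contributes three remainders of size
   [M * s ^+ 2]; one factor [s] is divided out. *)
have K s : 0 < s -> s <= d ->
    p (differential f x (m + u) + differential f x (m - u) -
       2 *: differential f x m) <= 6 * M * s.
  move=> s0 sd; have ns : `|s| <= d by rewrite gtr0_norm.
  have nNs : `|- s| <= d by rewrite normrN.
  have n0 : `|0 : R| <= d by rewrite normr0 ltW.
  have h1 := H 0 s m (m + u) n0 ns Bm Bp.
  have h2 := H 0 s m (m - u) n0 ns Bm Bn.
  have h3 := H 0 s m m n0 ns Bm Bm.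
  have h4 := H s s m u ns ns Bm Bu.
  have h5 := H s (- s) m u ns nNs Bm Bu.
  rewrite !scale0r !addr0 in h1 h2 h3.
  have xp : x + s *: m + s *: u = x + s *: (m + u) by rewrite -addrA -scalerDr.
  have xn : x + s *: m + - s *: u = x + s *: (m - u).
    by rewrite -addrA scaleNr -scalerBr.
  rewrite xp in h4; rewrite xn scaleNr sqrrN in h5.
  move: h1 h2 h3 h4 h5.
  set A1 := f (x + s *: (m + u)); set A2 := f (x + s *: (m - u)).
  set A3 := f (x + s *: m); set e1 := s *: differential f x (m + u).
  set e2 := s *: differential f x (m - u); set e3 := s *: differential f x m.
  set e4 := s *: differential f (x + s *: m) u => h1 h2 h3 h4 h5.
  have e13 := second_difference_aux A1 (f x) A3 e1 e3 e4.
  have e23 := second_difference_aux A2 (f x) A3 e2 e3 (- e4).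
  have : p (e1 - e3 - e4 + (e2 - e3 - - e4)) <= 6 * M * s ^+ 2.
    rewrite (le_trans (cseminormD _ _ hp))// e13 e23.
    have := cseminormD (A1 - A3 - e4 - (A1 - f x - e1)) (A3 - f x - e3) hp.
    have := cseminormB (A1 - A3 - e4) (A1 - f x - e1) hp.
    have := cseminormD (A2 - A3 - - e4 - (A2 - f x - e2)) (A3 - f x - e3) hp.
    have := cseminormB (A2 - A3 - - e4) (A2 - f x - e2) hp.
    lra.
  rewrite opprK addrACA addNr addr0 addrACA -opprD /e1 /e2 /e3 -!scalerDr -scalerBr.
  rewrite (cseminormZ _ _ hp) gtr0_norm// -mulr2n -scaler_nat.
  by rewrite expr2 mulrA [_ * s in X in _ <= X]mulrC ler_pM2l.
apply/eqP; rewrite eq_le cseminorm_ge0// andbT leNgt; apply/negP.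
set P := p _ in K * => P0.
have M0 : 0 < M.
  have := K d d0 (lexx d); rewrite -mulrA mulrC => h.
  have : 0 < M * d * 6 by rewrite (lt_le_trans P0)// mulrC.
  by rewrite pmulr_lgt0// pmulr_lgt0.
(* At this step size the upper bound [6 * M * s] is at most [P / 2], hence below [P]. *)
have s0 : 0 < Order.min d (P / (12 * M)).
  by rewrite lt_min d0 divr_gt0// mulr_gt0.
have := K _ s0; rewrite ge_min lexx /= => /(_ isT).
have sP : Order.min d (P / (12 * M)) <= P / (12 * M) by rewrite ge_min lexx orbT.
have : 6 * M * Order.min d (P / (12 * M)) <= 6 * M * (P / (12 * M)).
  by rewrite ler_wpM2l// mulr_ge0// ltW.
have -> : 6 * M * (P / (12 * M)) = P / 2 by field; rewrite gt_eqF.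
by lra.
Qed.

(** The midpoint identity with m = (v + w) / 2 and u = (v - w) / 2, followed by homogeneity. *)
Lemma differentialD (x v w : E) : N x ->
  differential f x (v + w) = differential f x v + differential f x w.
Proof.
move=> Nx; have := differential_midpoint (2^-1 *: (v + w)) (2^-1 *: (v - w)) Nx.
have n2 : (2 : R) != 0 by [].
rewrite -scalerDr addrACA subrr addr0 -mulr2n -[v *+ 2]scaler_nat scalerK//.
rewrite -scalerBr opprB [v + w]addrC addrACA subrr addr0 -mulr2n.
rewrite -[w *+ 2]scaler_nat scalerK// => ->.
by rewrite -differentialZ// scalerA mulfV// scale1r addrC.
Qed.

(** Write [c (t + h)] as [c t + h *: q + h ^+ 2 *: z], where [z] ranges over a bounded set because
    the second derivative of [c] is bounded near [t] in every seminorm. The Lipschitz estimate,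
    uniform in the direction [z], then shows that dropping the last term changes [f] by O(h^2), and
    along the line the derivative is the differential. *)
Lemma is_curve_derive_smooth_map (I : set R) (c : R -> E) (t : R) :
  open I -> smooth_curve I c -> (forall s, I s -> N (c s)) -> I t ->
  is_curve_derive (fun s => f (c s)) t (differential f (c t) (curve_derive c t)).
Proof.
move=> oI sc cN It.
have [r0 r00 Hr0] := (near_realP t I).1 (open_near oI It (fun s Is => Is)).
pose r := r0 / 2; have r_gt0 : 0 < r by rewrite divr_gt0.
have rI h : `|h| <= r -> I (t + h).
  by move=> hr; apply: Hr0; rewrite [t + h]addrC addrK (le_lt_trans hr)// /r; lra.
pose q := curve_derive c t; pose e h := c (t + h) - c t - h *: q.
pose B : set E := [set q] `|` [set (h ^+ 2)^-1 *: e h | h in [set h | `|h| <= r]].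
have bB : bounded_in B.
  apply: bounded_inU; first exact: bounded_in1.
  apply: seminorm_bounded_in => p hp.
  pose c2 := curve_derive (curve_derive c).
  have [C HC] : exists C, forall h, `|h| <= r -> p (c2 (t + h)) <= C.
    have cc : {within `[- r, r]%classic, continuous (fun h => p (c2 (t + h)))}.
      apply: continuous_in_subspaceT => h; rewrite inE /= in_itv /= -ler_norml => hr.
      apply: (@cseminorm_continuous R E (fun s => c2 (t + s)) h p hp).
      apply: (@is_curve_derive_continuous R E _ _ (curve_derive c2 (t + h))).
      apply/is_curve_derive_shift; apply: smooth_curve_deriveP (rI h hr).
      exact/smooth_curve_derive/smooth_curve_derive.
    have rr : - r <= r by lra.
    have [h0 _ Hh] := EVT_max rr cc.
    by exists (p (c2 (t + h0))) => h hr; apply: Hh; rewrite in_itv /= -ler_norml.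
  have e1 h : `|h| <= r -> p (curve_derive c (t + h) - q) <= C * `|h|.
    move=> hr; rewrite /q -{2}[t]addr0.
    apply: (cseminorm_mvt0 hp (c := fun s => curve_derive c (t + s))
      (c' := fun s => c2 (t + s))) => s sh.
    split; last by apply: HC; exact: le_trans hr.
    apply/is_curve_derive_shift; apply: smooth_curve_deriveP (smooth_curve_derive sc) _.
    by apply: rI; exact: le_trans hr.
  have e0 : e 0 = 0 by rewrite /e addr0 subrr scale0r subr0.
  have e2 h : `|h| <= r -> p (e h) <= C * h ^+ 2.
    move=> hr; rewrite -[e h]subr0 -e0 -[h ^+ 2]real_normK ?num_real// expr2 mulrA.
    apply: (cseminorm_mvt0 hp (c := e) (c' := fun s => curve_derive c (t + s) - q)).
    move=> s sh; split.
      apply: is_curve_deriveD.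
        rewrite -[curve_derive c (t + s)]addr0.
        apply: is_curve_deriveD; last exact: is_curve_derive_cst.
        apply/is_curve_derive_shift; apply: smooth_curve_deriveP sc _.
        by apply: rI; exact: le_trans hr.
      have := @is_curve_derive_line R E 0 (- q) s; congr is_curve_derive.
      by apply/funext => u; rewrite add0r scalerN.
    rewrite (le_trans (e1 s (le_trans sh hr)))// ler_wpM2l//.
    by apply: le_trans (HC 0 _); rewrite ?normr0 ?(ltW r_gt0)// cseminorm_ge0.
  exists `|C| => _ [h hr <-].
  rewrite (cseminormZ _ _ hp).
  have [->|h0] := eqVneq h 0; first by rewrite expr0n invr0 normr0 mul0r.
  have h2 : 0 < h ^+ 2 by rewrite exprn_even_gt0.
  rewrite gtr0_norm ?invr_gt0// ler_pdivrMl// mulrC (le_trans (e2 h hr))//.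
  by rewrite ler_wpM2r ?sqr_ge0// ler_norm.
have line := @is_curve_derive_differential (c t) q (cN t It).
have rem : is_curve_derive (fun h => f (c (t + h)) - f (c t + h *: q)) 0 0.
  apply: is_curve_derive0_seminorm; first by rewrite addr0 scale0r addr0 subrr.
  move=> p hp; have [d [M [d0 H]]] := smooth_map_lipschitz hE hG oN (cN t It) sf bB hp.
  (* The bound 1 ensures [h ^+ 2 <= d], as required of the second coefficient in the Lipschitz
     estimate. *)
  exists M, (Order.min r (Order.min d 1)); split.
    by rewrite !lt_min r_gt0 d0 ltr01.
  move=> h; rewrite !lt_min addr0 => /and3P[/ltW hr /ltW hd /ltW h1].
  have [->|h0] := eqVneq h 0.
    by rewrite addr0 scale0r addr0 subrr cseminorm0// expr0n mulr0.
  have hh : h ^+ 2 != 0 by rewrite expf_neq0.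
  have -> : c (t + h) = c t + h *: q + h ^+ 2 *: ((h ^+ 2)^-1 *: e h).
    by rewrite scalerA divff// scale1r /e -[c (t + h) - _ - _]addrA -opprD [RHS]addrC subrK.
  have := H h (h ^+ 2) q ((h ^+ 2)^-1 *: e h) hd.
  rewrite [`|h ^+ 2|]ger0_norm ?sqr_ge0//; apply.
  - rewrite (le_trans _ hd)// -[h ^+ 2]real_normK ?num_real//.
    by rewrite expr2 ger_pMl ?normr_gt0.
  - by left.
  - by right; exists h.
have := is_curve_deriveD line rem; rewrite addr0 => D.
have := (is_curve_derive_shift (fun s => f (c s)) 0 t
  (differential f (c t) q)).1; rewrite addr0; apply.
have : (fun s => f (c t + s *: q) + (f (c (t + s)) - f (c t + s *: q))) =
    (fun s => f (c (t + s))) by apply/funext => s; rewrite addrC subrK.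
by move=> <-.
Qed.

End Differentials.

Lemma frechet_hausdorff (R : realType) (E : tvsType R) :
  frechet E -> hausdorff_space E.
Proof.
move=> [d [[d0 dC dT _] dN _]] x y cl; apply/d0.
have dge0 : 0 <= d x y.
  have := dT x y x; rewrite (dC y x) ((d0 x x).2 erefl).
  by rewrite -mulr2n pmulrn_lge0.
apply/eqP; rewrite eq_le dge0 andbT; apply/ler_addgt0Pr => e e0; rewrite add0r.
have e2 : 0 < e / 2 by rewrite divr_gt0.
have Bx z : nbhs z [set u | d z u < e / 2] by apply/dN; exists (e / 2).
have [z [/= xz yz]] := cl _ _ (Bx x) (Bx y).
by have := dT x z y; rewrite (dC z y); lra.
Qed.

(** * Continuity of differentials and comparison of integrals *)

Section FirstVariation.
Variable R : realType.

Lemma smooth_map_pair (G : tvsType R) (I : set R) (f : R^o * R^o -> G) :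
  (forall a b : R -> R^o, smooth_curve setT a -> smooth_curve setT b ->
     (forall s, I (b s)) -> smooth_curve setT (fun s => f (a s, b s))) ->
  smooth_map ([set: R^o] `*` (I : set R^o)) f.
Proof.
move=> H c sc cI.
have -> : f \o c = fun s => f ((c s).1, (c s).2).
  by apply/funext => s /=; rewrite -surjective_pairing.
apply: H => [||s]; first exact: smooth_curve_fst sc.
  exact: smooth_curve_snd sc.
by have [] := cI s.
Qed.

Lemma first_difference_aux (V : zmodType) (A B C D e0 ea : V) :
  ea - e0 = (B - D - e0) - (A - C - ea) + ((A - B) - (C - D)).
Proof.
have -> : A - B - (C - D) = A - C - (B - D) by rewrite !opprB addrACA [- B - C]addrC addrACA.
rewrite opprB -addrA [ea - _ + _]addrA subrK [B - D - e0]addrC addrACA subrr addr0.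
by rewrite addrC.
Qed.

(** A difference quotient with fixed step [b] is continuous in [a] at 0, and by the uniform
    expansion it is within [M * b] of the differential for all small [a]. *)
Lemma differential_continuous (E G : tvsType R) (N : set E) (f : E -> G) (x v w : E) :
  hausdorff_space E -> hausdorff_space G -> open N -> smooth_map N f -> N x ->
  {for 0, continuous (fun a : R^o => differential f (x + a *: w) v)}.
Proof.
move=> hE hG oN sf Nx; apply: cseminorm_cvg => p e hp e0.
pose B := [set v] `|` [set w].
have bB : bounded_in B by apply: bounded_inU; exact: bounded_in1.
have [d [M [d0 H]]] := smooth_map_taylor2 hE hG oN Nx sf bB hp.
have [d1 d10 Nd] := nbhs_bounded_in oN Nx bB.
(* [b] is fixed before [a]. The two expansion errors and the two continuity errors are then at most
   [e * b / 8] each, against the target [e * b]. *)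
pose b := Order.min (Order.min d d1) (e / (8 * (`|M| + 1))).
have M0 : 0 < 8 * (`|M| + 1) by rewrite mulr_gt0// ltr_pwDr.
have b0 : 0 < b by rewrite !lt_min d0 d10 divr_gt0.
have [bd bd1] : `|b| <= d /\ `|b| <= d1.
  by rewrite gtr0_norm// !ge_min !lexx !orbT.
have Mb : M * b <= e / 8.
  apply: (@le_trans _ _ ((`|M| + 1) * b)).
    by rewrite ler_pM2r// (le_trans (ler_norm _))// lerDl.
  apply: (@le_trans _ _ ((`|M| + 1) * (e / (8 * (`|M| + 1))))).
    by rewrite ler_pM2l ?ltr_pwDr// ge_min lexx orbT.
  by rewrite le_eqVlt; apply/orP; left; apply/eqP; field; rewrite gt_eqF// ltr_pwDr.
have eb : 0 < e * b / 8 by rewrite divr_gt0// mulr_gt0.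
have Bv : B v by left.
have Bw : B w by right.
have cont y : N (x + y) -> \forall a \near (0 : R^o),
    p (f (x + a *: w + y) - f (x + y)) < e * b / 8.
  move=> Ny; have sl := @smooth_map_line R E G N f hE oN sf (x + y) w.
  have c0 := smooth_curve_continuous sl (t := 0).
  rewrite /= scale0r addr0 in c0; have [r r0 Hr] := (near_realP _ _).1 (cvg_cseminorm _ hp eb (c0 Ny)).
  apply/near_realP; exists r => // a ar.
  by have := Hr a ar; rewrite scale0r addr0 addrAC.
have n0 : `|0 : R| <= d1 by rewrite normr0 ltW.
have Nb : N (x + b *: v).
  by have := Nd 0 b v v n0 bd1 Bv Bv; rewrite scale0r addr0.
have H0 := cont 0; rewrite addr0 in H0; have {}H0 := H0 Nx.
near=> a.
have ca : p (f (x + a *: w + b *: v) - f (x + b *: v)) < e * b / 8.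
  by near: a; exact: cont.
have ca0 : p (f (x + a *: w) - f x) < e * b / 8.
  by rewrite -[x + a *: w]addr0; near: a; exact: H0.
have ad : `|a| <= d.
  by near: a; apply: (@nbhs0_le R R^o).
have T0 := H 0 b w v _ bd Bw Bv; rewrite normr0 scale0r addr0 in T0.
have {}T0 := T0 (ltW d0).
have Ta := H a b w v ad bd Bw Bv.
rewrite scale0r addr0.
have := first_difference_aux (f (x + a *: w + b *: v)) (f (x + b *: v))
  (f (x + a *: w)) (f x) (b *: differential f x v) (b *: differential f (x + a *: w) v).
rewrite -scalerBr => h.
have : p (b *: (differential f (x + a *: w) v - differential f x v)) <=
    M * b ^+ 2 + M * b ^+ 2 + (e * b / 8 + e * b / 8).
  rewrite h (le_trans (cseminormD _ _ hp))// lerD//.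
    by rewrite (le_trans (cseminormB _ _ hp))// lerD.
  by rewrite (le_trans (cseminormB _ _ hp))// lerD// ltW.
rewrite (cseminormZ _ _ hp) gtr0_norm// => {}h.
rewrite -(ltr_pM2l b0) (le_lt_trans h)//.
have : M * b ^+ 2 <= e / 8 * b by rewrite expr2 mulrA ler_pM2r.
have : 0 < e * b by rewrite mulr_gt0.
by lra.
Unshelve. all: by end_near. Qed.

Lemma smooth_integrable (I J : set R) (f : R -> R^o) :
  open J -> compact (closure J) -> closure J `<=` I -> smooth_curve I f ->
  (@lebesgue_measure R).-integrable J (EFin \o f).
Proof.
move=> oJ cJ JI sf.
have cf : {within closure J, continuous f}.
  apply: continuous_in_subspaceT => t /set_mem Jt.
  by apply: smooth_curve_continuous sf _; exact: JI.
have mJ : measurable J by exact: measurable_realfun.open_measurable.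
have mcJ : measurable (closure J).
  by apply: measurable_realfun.closed_measurable; exact: closed_closure.
apply: integrableS (continuous_compact_integrable cJ cf) => //.
exact: subset_closure.
Qed.

(** This stands in for differentiation under the integral sign: off the compact interval the
    integrands cancel, and on it a bound by a derivative integrates to boundary values of [H]. *)
Lemma Rintegral_difference_le (I J : set R) (f g H : R -> R^o) (al be : R) :
  al < be -> open I -> open J -> compact (closure J) -> closure J `<=` I ->
  `[al, be]%classic `<=` J ->
  smooth_curve I f -> smooth_curve I g -> smooth_curve I H ->
  (forall t, J t -> ~ `[al, be]%classic t -> f t = g t) ->
  (forall t, `[al, be]%classic t -> f t - g t <= curve_derive H t) ->
  \int[@lebesgue_measure R]_(t in J) (f t : R) -
  \int[@lebesgue_measure R]_(t in J) (g t : R) <= H be - H al.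
Proof.
move=> ab oI oJ cJ JI KJ sf sg sH fg fgH.
pose K : set R := `[al, be]%classic.
have mK : measurable K by exact: measurable_itv.
have mJ : measurable J by exact: measurable_realfun.open_measurable.
have mJK : measurable (J `\` K) by exact: measurableD.
have cK : compact K by exact: segment_compact.
have KI t : K t -> I t by move=> /KJ/subset_closure/JI.
have intJ (h : R -> R^o) : smooth_curve I h ->
  (@lebesgue_measure R).-integrable J (EFin \o h) by exact: smooth_integrable.
have cont (h : R -> R^o) : smooth_curve I h -> {within K, continuous h}.
  move=> sh; apply: continuous_in_subspaceT => t /set_mem Kt.
  exact: smooth_curve_continuous sh (KI t Kt).
have intK (h : R -> R^o) : smooth_curve I h ->
    (@lebesgue_measure R).-integrable K (EFin \o h).
  by move=> sh; apply: continuous_compact_integrable => //; exact: cont.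
have split_int (h : R -> R^o) : smooth_curve I h ->
    \int[@lebesgue_measure R]_(t in J) (h t : R) =
    \int[@lebesgue_measure R]_(t in K) (h t : R) +
    \int[@lebesgue_measure R]_(t in J `\` K) (h t : R).
  move=> sh; rewrite -{1}(setDUK KJ) Rintegral_setU ?setDUK//; first exact: intJ.
  by apply/disj_setPS => t [Kt []].
have fgJK : \int[@lebesgue_measure R]_(t in J `\` K) (f t : R) =
    \int[@lebesgue_measure R]_(t in J `\` K) (g t : R).
  by apply: eq_Rintegral => t /set_mem [Jt nKt]; exact: fg.
rewrite !split_int// fgJK.
rewrite opprD addrACA subrr addr0 -RintegralB//; [|exact: intK..].
have sH' := smooth_curve_derive sH.
have sfg : smooth_curve I (fun t => f t - g t).
  apply: (@smooth_curveD R R^o) => //.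
  have := @smooth_curveZ R R^o I (fun=> -1) g (@hausdorff_Ro R) oI.
  rewrite (_ : (fun t => -1 *: g t) = (fun t => - g t)); last first.
    by apply/funext => t; rewrite scaleN1r.
  by apply=> //; exact: smooth_curve_cst.
apply: (@le_trans _ _ (\int[@lebesgue_measure R]_(t in K) (curve_derive H t : R))).
  by apply: le_Rintegral => //; exact: intK.
rewrite /Rintegral (@continuous_FTC2 R _ H)//=.
- exact: cont.
- split.
  + move=> t tab; have Kt : K t by exact: subset_itv_oo_cc.
    have [] // := is_derive_is_curve_derive (smooth_curve_deriveP sH (KI t Kt)).
  + apply: cvg_at_right_filter; apply: smooth_curve_continuous sH _.
    by apply: KI; rewrite /K /= in_itv /= lexx ltW.
  + apply: cvg_at_left_filter; apply: smooth_curve_continuous sH _.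
    by apply: KI; rewrite /K /= in_itv /= lexx ltW.
Qed.

End FirstVariation.

(** * The variation along the vector field and its first order effect *)

Section CriticalCurves.
Variable R : realType.

Lemma smooth_sin : smooth_curve setT (sin : R -> R^o).
Proof.
apply: (@smooth_curve_coind R R^o setT (fun f => exists u v : R,
    f = fun s => u * sin s + v * cos s)) => //.
- move=> _ [u [v ->]]; exists (fun s => (- v) * sin s + u * cos s).
    by exists (- v), u.
  move=> t _; apply: is_curve_derive_is_derive.
  by apply: is_derive_eq; rewrite /GRing.scale /=; ring.
- by exists 1, 0; apply/funext => s; rewrite mul1r mul0r addr0.
Qed.

Variables (E : tvsType R) (N : set E) (L : E * E -> R^o) (X : E -> E) (F : E -> R^o).
Hypotheses (hE : hausdorff_space E) (oN : open N).
Hypotheses (sL : smooth_map (N `*` [set: E]) L) (sX : smooth_map N X).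
Hypothesis sF : smooth_map N F.

Lemma open_phase_space : open (N `*` [set: E]).
Proof.
rewrite openE => -[g k] [/= Ng _]; exists (N, setT) => //; split => //=.
  exact: open_nbhs_nbhs.
exact: filterT.
Qed.

Let hEE : hausdorff_space (E * E)%type := hausdorff_prod hE hE.
Let oNE := open_phase_space.

(** Seeing both partial differentials inside one differential on the product makes additivity
    applicable to their sum. *)
Lemma D1E g k h : D1 L g k h = differential L (g, k) (h, 0).
Proof.
rewrite /D1 /differential; congr curve_derive; apply/funext => s.
by congr (L (_, _)); rewrite /= scaler0 addr0.
Qed.

Lemma D2E g k h : D2 L g k h = differential L (g, k) (0, h).
Proof.
rewrite /D2 /differential; congr curve_derive; apply/funext => s.
by congr (L (_, _)); rewrite /= scaler0 addr0.
Qed.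

Lemma noetherE (c : R -> E) t : noether L X (velocity_lift c t) =
  differential L (velocity_lift c t) (0, X (c t)).
Proof. exact: D2E. Qed.

Section Curve.
Variables (I : set R) (c : R -> E).
Hypotheses (oI : open I) (sc : smooth_curve I c) (cN : forall t, I t -> N (c t)).

Lemma open_strip : open ([set: R^o] `*` (I : set R^o)).
Proof.
rewrite openE => -[g k] [/= _ Ik]; exists (setT, I) => //; split => //=.
  exact: filterT.
exact: open_nbhs_nbhs.
Qed.

Lemma smooth_velocity_lift : smooth_curve I (velocity_lift c).
Proof. by apply: smooth_curve_pair => //; exact: smooth_curve_derive. Qed.

Lemma velocity_lift_in t : I t -> (N `*` [set: E]) (velocity_lift c t).
Proof. by move=> /cN. Qed.

Lemma smooth_X_curve : smooth_curve I (fun t => X (c t)).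
Proof. exact: smooth_map_curve sX sc cN. Qed.

(** The Noether function at time [s] is the partial derivative at u = 0 of [L (velocity_lift c s + u
    *: (0, X (c s)))], a smooth map of two real variables, so [differential_continuous] applies in
    the direction of [s]. *)
Lemma noether_continuous t : I t ->
  {for t, continuous (fun s : R^o => noether L X (velocity_lift c s) : R)}.
Proof.
move=> It.
pose f (p : R^o * R^o) : R^o := L (velocity_lift c p.2 + p.1 *: (0, X (c p.2))).
have sf : smooth_map ([set: R^o] `*` (I : set R^o)) f.
  apply: smooth_map_pair => a b sa sb bI.
  apply: smooth_map_curve sL _ _ => // [|s _]; last first.
    by split=> //=; rewrite scaler0 addr0; exact: cN.
  apply: smooth_curveD => //; first exact: smooth_curve_comp sb _ smooth_velocity_lift.
  apply: smooth_curveZ => //; apply: smooth_curve_pair => //.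
    exact: smooth_curve_cst.
  exact: smooth_curve_comp sb _ smooth_X_curve.
have h2 : hausdorff_space (R^o * R^o)%type by exact: hausdorff_prod.
have cf := @differential_continuous R _ _ _ f (0, t) (1, 0) (0, 1) h2
  (@hausdorff_Ro R) open_strip sf (conj Logic.I It).
have E1 s : noether L X (velocity_lift c s) =
    differential f ((0, t) + (s - t) *: (0, 1)) (1, 0).
  have fE u : f ((0, t) + (s - t) *: (0, 1) + u *: (1, 0)) =
      L (velocity_lift c s + u *: (0, X (c s))).
    have -> : (0, t) + (s - t) *: (0, 1) + u *: (1, 0) = (u, s) :> R^o * R^o.
      congr pair; rewrite /= /GRing.scale /=; ring.
    by [].
  rewrite noetherE /differential; congr (curve_derive _ 0).
  by apply/funext => u; rewrite fE.
have H2 : (fun s : R^o => (s - t : R^o)) @ (t : R^o) --> (0 : R^o).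
  rewrite -[X in _ --> X](subrr t).
  by apply: cvgB; [exact: cvg_id|exact: cvg_cst].
rewrite /prop_for /continuous_at.
rewrite (_ : (fun s => _) = (fun a : R^o => differential f ((0, t) + a *: (0, 1)) (1, 0))
    \o (fun s => s - t)); last by apply/funext => s; exact: E1.
by rewrite E1 subrr; apply: cvg_comp H2 cf.
Qed.

(** By the chain rule the time derivative of X along [c] is DX(c)(c'), so the terms carrying [a] are
    exactly the left side of the invariance at (c, c'); the term carrying [b] is the Noether
    function. *)
Lemma invariant_differential (a b t : R) : invariant_up_to N L X F -> I t ->
  differential L (velocity_lift c t)
    (a *: X (c t), b *: X (c t) + a *: curve_derive (fun s => X (c s)) t) =
  a * curve_derive (fun s => F (c s)) t + b * noether L X (velocity_lift c t).
Proof.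
move=> inv It; have Nt := velocity_lift_in It.
have XE : curve_derive (fun s => X (c s)) t =
    differential X (c t) (curve_derive c t).
  apply: curve_deriveE => //.
  exact: (is_curve_derive_smooth_map hE hE oN sX oI sc cN It).
have FE : curve_derive (fun s => F (c s)) t =
    differential F (c t) (curve_derive c t).
  apply: curve_deriveE => //.
  exact: (is_curve_derive_smooth_map hE (@hausdorff_Ro R) oN sF oI sc cN It).
set Y := curve_derive (fun s => X (c s)) t.
have -> : (a *: X (c t), b *: X (c t) + a *: Y) =
    a *: (X (c t), 0) + (b *: (0, X (c t)) + a *: (0, Y)) :> E * E.
  by congr pair; rewrite /= !scaler0 ?addr0 ?add0r.
rewrite !(differentialD hEE _ oNE sL)// !(differentialZ hEE _ oNE sL)//.
by rewrite noetherE FE -(inv _ _ (cN It)) D1E !D2E -XE /GRing.scale /=; ring.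
Qed.

(** Joint continuity in [t] and [r] at [r = 0], made uniform in [t] by compactness of [K]. *)
Lemma curve_tube (K : set R) : compact K -> K `<=` I ->
  exists2 d : R, 0 < d & forall t r, K t -> `|r| <= d -> N (c t + r *: X (c t)).
Proof.
move=> /compact_near_coveringP cK KI.
have K0 : \forall r \near (0 : R^o), K `<=` (fun t => N (c t + r *: X (c t))).
  apply: (cK R^o (nbhs (0 : R^o)) (fun r t => N (c t + r *: X (c t)))) => t Kt.
  have It := KI t Kt.
  have H : (fun z : R * R^o => c z.1 + z.2 *: X (c z.1)) @
      filter_prod (nbhs t) (nbhs (0 : R^o)) --> c t + (0 : R^o) *: X (c t).
    have fst_t : (fun z : R * R^o => z.1 : R^o) @ filter_prod (nbhs t) (nbhs (0 : R^o)) --> (t : R^o).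
      exact: cvg_fst.
    apply: cvg_tvsD.
      exact: (cvg_comp _ (c : R^o -> E) fst_t (smooth_curve_continuous sc It)).
    apply: cvg_tvsZ; first exact: cvg_snd.
    exact: (cvg_comp _ (fun u : R^o => X (c u)) fst_t
      (smooth_curve_continuous smooth_X_curve It)).
  rewrite scale0r addr0 in H.
  exact: H N (open_nbhs_nbhs (conj oN (cN It))).
have [d d0 Hd] := (near_realP _ _).1 K0.
exists (d / 2); first by rewrite divr_gt0.
move=> t r Kt rd; apply: (Hd r) => //; rewrite subr0 (le_lt_trans rd)//.
by rewrite ltr_pdivrMr// ltr_pMr// ltr1n.
Qed.

Section Variation.
Variables (phi : R -> R^o) (al be d : R).
Hypotheses (ab : al < be) (KI : `[al, be]%classic `<=` I) (d0 : 0 < d).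
Hypotheses (sphi : smooth_curve setT phi) (phi1 : forall t, `|phi t| <= 1).
Hypothesis phi0 : forall t, ~ `[al, be]%classic t -> phi t = 0.
Hypothesis tube : forall t r, `[al, be]%classic t -> `|r| <= d ->
  N (c t + r *: X (c t)).

Definition noether_variation (p : R^o * R^o) : E :=
  c p.2 + (d * sin p.1 * phi p.2) *: X (c p.2).

(** The pair of phi X and its time derivative along [c]: the lifted variation is affine in
    [d * sin s] with this direction. *)
Definition variation_velocity (t : R) : E * E :=
  (phi t *: X (c t), curve_derive phi t *: X (c t) +
     phi t *: curve_derive (fun s => X (c s)) t).

Definition varied_lagrangian (p : R^o * R^o) : R^o :=
  L (velocity_lift c p.2 + (d * sin p.1) *: variation_velocity p.2).

Lemma noether_variation_in s t : I t -> N (noether_variation (s, t)).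
Proof.
move=> It; rewrite /noether_variation /=.
have [Kt|nKt] := pselect (`[al, be]%classic t).
  apply: tube => //; rewrite !normrM (gtr0_norm d0) -mulrA ger_pMr//.
  by rewrite mulr_ile1// ler_norml sin_geN1 sin_le1.
by rewrite phi0// mulr0 scale0r addr0; exact: cN.
Qed.

Lemma smooth_noether_variation a b : smooth_curve setT a -> smooth_curve setT b ->
  (forall s : R, I (b s)) -> smooth_curve setT (fun s => noether_variation (a s, b s)).
Proof.
move=> sa sb bI; apply: smooth_curveD => //; first exact: smooth_curve_comp sb _ sc.
apply: smooth_curveZ => //; last exact: smooth_curve_comp sb _ smooth_X_curve.
apply: (@smooth_curveZ R R^o setT (fun s => d * sin (a s)) (fun s => phi (b s))) => //.
  apply: (@smooth_curveZ R R^o setT (fun=> d) (fun s => sin (a s))) => //.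
    exact: smooth_curve_cst.
  exact: (smooth_curve_comp _ _ _ sa _ smooth_sin).
exact: smooth_curve_comp sb _ sphi.
Qed.

Lemma noether_variationP :
  compact_variation N I c noether_variation `[al, be]%classic.
Proof.
split.
- by apply: smooth_map_pair; exact: smooth_noether_variation.
- exact: noether_variation_in.
- by move=> t _; rewrite /noether_variation /= sin0 mulr0 mul0r scale0r addr0.
- by split=> //; exact: segment_compact.
- by move=> s t _ nKt; rewrite /noether_variation /= phi0// mulr0 scale0r addr0.
Qed.

Lemma velocity_lift_variation s t : I t ->
  velocity_lift (fun t => noether_variation (s, t)) t =
  velocity_lift c t + (d * sin s) *: variation_velocity t.
Proof.
move=> It; congr pair; first by rewrite /= scalerA.
apply: curve_deriveE => //; apply: is_curve_deriveD; first exact: smooth_curve_deriveP It.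
have dphi : is_curve_derive (fun t => d * sin s * phi t : R^o) t
    (d * sin s * curve_derive phi t).
  have := is_curve_deriveZ (is_curve_derive_cst (d * sin s : R^o) t)
    (smooth_curve_deriveP sphi Logic.I).
  by rewrite scale0r add0r.
have := is_curve_deriveZ dphi (smooth_curve_deriveP smooth_X_curve It).
by congr is_curve_derive; rewrite /= scalerDr !scalerA.
Qed.

Lemma smooth_variation_velocity : smooth_curve I variation_velocity.
Proof.
have sphiI := smooth_curveW (@subsetT _ I) sphi.
apply: smooth_curve_pair => //; first exact: smooth_curveZ smooth_X_curve.
apply: smooth_curveD => //.
  by apply: smooth_curveZ => //; [exact: smooth_curve_derive|exact: smooth_X_curve].
by apply: smooth_curveZ => //; apply: smooth_curve_derive; exact: smooth_X_curve.
Qed.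

Lemma varied_in s t : I t ->
  (N `*` [set: E]) (velocity_lift c t + (d * sin s) *: variation_velocity t).
Proof. by move=> It; split=> //; rewrite /= scalerA; exact: noether_variation_in. Qed.

Lemma smooth_varied_lagrangian_slice s :
  smooth_curve I (fun t => varied_lagrangian (s, t)).
Proof.
apply: smooth_map_curve sL _ _ => // [|t It]; last exact: varied_in.
apply: smooth_curveD => //; first exact: smooth_velocity_lift.
apply: smooth_curveZ => //; last exact: smooth_variation_velocity.
exact: (@smooth_curve_cst R R^o I (d * sin s : R^o)).
Qed.

Lemma smooth_varied_lagrangian :
  smooth_map ([set: R^o] `*` (I : set R^o)) varied_lagrangian.
Proof.
apply: smooth_map_pair => a b sa sb bI.
apply: smooth_map_curve sL _ _ => // [|s _]; last exact/varied_in/bI.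
apply: smooth_curveD => //; first exact: smooth_curve_comp sb _ smooth_velocity_lift.
apply: smooth_curveZ => //; last exact: smooth_curve_comp sb _ smooth_variation_velocity.
apply: (@smooth_curveZ R R^o setT (fun=> d) (fun s => sin (a s))) => //.
  exact: smooth_curve_cst.
exact: (smooth_curve_comp _ _ _ sa _ smooth_sin).
Qed.

Lemma differential_varied_lagrangian t : I t ->
  differential varied_lagrangian (0, t) (1, 0) =
  d * differential L (velocity_lift c t) (variation_velocity t).
Proof.
move=> It; apply: curve_deriveE => //.
have vE u : varied_lagrangian ((0, t) + u *: (1, 0)) =
    L (velocity_lift c t + (d * sin u) *: variation_velocity t).
  have -> : (0, t) + u *: (1, 0) = (u, t) :> R^o * R^o.
    by congr pair; rewrite /= /GRing.scale /=; ring.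
  by [].
have -> : (fun u => varied_lagrangian ((0, t) + u *: (1, 0))) =
    (fun u => L (velocity_lift c t + (d * sin u) *: variation_velocity t)).
  by apply/funext => u; exact: vE.
have dsin : is_curve_derive (fun u => d * sin u : R^o) 0 d.
  apply: is_curve_derive_is_derive.
  by apply: is_derive_eq; rewrite cos0 /GRing.scale /= mulr1.
apply: (is_curve_derive_comp (c := fun r : R => L (velocity_lift c t + r *: variation_velocity t)) dsin).
rewrite sin0 mulr0.
exact: (is_curve_derive_differential hEE oNE sL (velocity_lift_in It)).
Qed.

Lemma lagrangian_action_variation (J : set R) s : J `<=` I ->
  lagrangian_action L J (fun t => noether_variation (s, t)) =
  \int[lebesgue_measure]_(t in J) (varied_lagrangian (s, t) : R).
Proof.
move=> JI; apply: eq_Rintegral => t /set_mem/JI It.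
by rewrite velocity_lift_variation.
Qed.

Lemma varied_lagrangian_eq s t : ~ `[al, be]%classic t ->
  varied_lagrangian (s, t) = varied_lagrangian (0, t).
Proof.
move=> nKt; rewrite /varied_lagrangian /=.
have -> : variation_velocity t = 0.
  rewrite /variation_velocity phi0// (_ : curve_derive phi t = 0) ?scale0r ?addr0//.
  apply: curve_deriveE => //.
  apply: (@near_is_curve_derive _ _ (fun=> 0)); last exact: is_curve_derive_cst.
  have oK : open (~` `[al, be]%classic : set R).
    by apply: closed_openC; exact: interval_closed.
  by apply: (open_near oK nKt) => u nKu; rewrite phi0.
by rewrite !scaler0.
Qed.

(** The uniform second order expansion on the strip, with base points [(0, u)] for [u] near [t] and
    direction [(1, 0)]; the error [M * s ^+ 2] is below [s * d * eta] for small [s]. *)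
Lemma varied_lagrangian_near (t eta : R) : I t -> 0 < eta ->
  exists2 r : R, 0 < r & forall s u : R, 0 < s -> s < r -> `|u - t| < r -> I u ->
    varied_lagrangian (s, u) - varied_lagrangian (0, u) <=
    s * d * (differential L (velocity_lift c u) (variation_velocity u) + eta).
Proof.
move=> It eta0; pose B : set (R^o * R^o) := [set (1, 0)] `|` [set (0, 1)].
have bB : bounded_in B by apply: bounded_inU; exact: bounded_in1.
have h2 : hausdorff_space (R^o * R^o)%type by exact: hausdorff_prod.
have [r [M [r0 H]]] := smooth_map_taylor2 h2 (@hausdorff_Ro R) open_strip
  (conj Logic.I It : ([set: R^o] `*` (I : set R^o)) (0, t)) smooth_varied_lagrangian
  bB (cseminorm_abs R).
have M0 : 0 < `|M| + 1 by rewrite ltr_pwDr.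
exists (Order.min r (d * eta / (`|M| + 1))).
  by rewrite lt_min r0 divr_gt0// mulr_gt0.
move=> s u s0; rewrite !lt_min ltr_pdivlMr// => /andP[sr sM] /andP[/ltW ur _] Iu.
have sr' : `|s| <= r by rewrite gtr0_norm// ltW.
have E1 : (0, t) + (u - t) *: (0, 1) = (0, u) :> R^o * R^o.
  by congr pair; rewrite /= /GRing.scale /=; ring.
have E2 : (0, u) + s *: (1, 0) = (s, u) :> R^o * R^o.
  by congr pair; rewrite /= /GRing.scale /=; ring.
have := H (u - t) s (0, 1) (1, 0) ur sr' (or_intror erefl) (or_introl erefl).
rewrite E1 E2 differential_varied_lagrangian// => /ler_normlW.
rewrite /GRing.scale /=.
have : M * s ^+ 2 <= s * (d * eta).
  rewrite expr2 mulrA [X in _ <= X]mulrC ler_pM2r// (le_trans _ (ltW sM))//.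
  by rewrite mulrC ler_pM2l// (le_trans (ler_norm _))// lerDl.
by rewrite !mulrDr !mulrA; lra.
Qed.

(** If [W] decreased from [al] to [be], integrating the pointwise bound would make the action drop
    at least linearly in small [s > 0], against its zero derivative. *)
Lemma noether_first_variation (W : R -> R^o) :
  critical N L I c -> smooth_curve I W ->
  (forall t, `[al, be]%classic t ->
     differential L (velocity_lift c t) (variation_velocity t) <= curve_derive W t) ->
  W al <= W be.
Proof.
move=> [_ _ crit] sW DW; rewrite leNgt; apply/negP => Wlt.
have [J [oJ cJ JI KJ dA]] := crit _ _ noether_variationP.
have JI' : J `<=` I by move=> t /subset_closure/JI.
have ab0 : 0 < be - al by rewrite subr_gt0.
(* The accumulated error [eta * (be - al)] uses up half of the gap [W al - W be]; the other half
   bounds the difference quotient away from 0. *)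
pose eta := (W al - W be) / (2 * (be - al)).
have eta0 : 0 < eta by rewrite divr_gt0 ?subr_gt0// mulr_gt0.
(* The condition [0 < s] belongs to [P] because compactness yields a two-sided neighbourhood of 0,
   while the estimate is one-sided. *)
pose P (s u : R) := 0 < s -> I u ->
  varied_lagrangian (s, u) - varied_lagrangian (0, u) <=
    s * d * (differential L (velocity_lift c u) (variation_velocity u) + eta).
have K0 : \forall s \near (0 : R^o), `[al, be]%classic `<=` P s.
  have /compact_near_coveringP cK := @segment_compact R al be.
  apply: (cK R^o (nbhs (0 : R^o)) P) => t /KI It.
  have [r r0 Hr] := varied_lagrangian_near It eta0.
  exists ([set u : R | `|u - t| < r], [set s : R | `|s - 0| < r]) => /=.
    by split; apply/near_realP; exists r.
  move=> [u s] /= [ur sr] s0 Iu; apply: Hr => //.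
  by move: sr; rewrite subr0 gtr0_norm.
have [r1 r10 Hr1] := (near_realP _ _).1 K0.
pose A s := lagrangian_action L J (fun t => noether_variation (s, t)).
have /is_curve_deriveP [q [q0 _ qE]] : is_curve_derive (A : R -> R^o) 0 0.
  exact: is_curve_derive_is_derive dA.
have kap0 : 0 < d * ((W al - W be) / 2) by rewrite mulr_gt0// divr_gt0// subr_gt0.
have [r2 r20 Hr2] := (near_realP _ _).1 (cvg_cseminorm _ (cseminorm_abs R) kap0 q0).
pose s := Order.min r1 r2 / 2.
have s0 : 0 < s by rewrite divr_gt0// lt_min r10.
have [sr1 sr2] : s < r1 /\ s < r2.
  have : s < Order.min r1 r2.
    by rewrite ltr_pdivrMr// ltr_pMr ?ltr1n// lt_min r10.
  by rewrite lt_min => /andP.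
have Ks : `[al, be]%classic `<=` P s by apply: Hr1; rewrite subr0 gtr0_norm.
have qs : `|q s - 0| < d * ((W al - W be) / 2) by apply: Hr2; rewrite subr0 gtr0_norm.
(* A primitive of [s * d] times the derivative of [W] plus [eta], which dominates the increment of
   the integrand. *)
pose H t : R^o := (s * d) *: (W t + (0 + t *: (eta : R^o)) : R^o).
have dH t : I t -> is_curve_derive H t ((s * d) *: (curve_derive W t + eta : R^o)).
  move=> It.
  have := is_curve_deriveZ (is_curve_derive_cst (s * d : R^o) t)
    (is_curve_deriveD (smooth_curve_deriveP sW It) (@is_curve_derive_line R R^o 0 eta t)).
  by rewrite scale0r add0r.
have sH : smooth_curve I H.
  apply: smooth_curveZ => //; first exact: (@smooth_curve_cst R R^o I (s * d : R^o)).
  by apply: smooth_curveD => //; exact: smooth_curve_line.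
have := @Rintegral_difference_le R I J (fun t => varied_lagrangian (s, t))
  (fun t => varied_lagrangian (0, t)) H al be ab oI oJ cJ JI KJ
  (smooth_varied_lagrangian_slice s) (smooth_varied_lagrangian_slice 0) sH.
rewrite -!(lagrangian_action_variation _ JI') => /(_ _)/wrap[].
  by move=> t _ nKt; exact: varied_lagrangian_eq.
move=> /(_ _)/wrap[] => [t Kt|].
  rewrite (curve_deriveE (@hausdorff_Ro R) (dH t (KI Kt))) (le_trans (Ks t Kt s0 (KI Kt)))//.
  rewrite /GRing.scale /= ler_pM2l; last exact: mulr_gt0.
  by apply: lerD => //; exact: DW.
have As : A s = A 0 + s * q s by rewrite -[s in LHS]addr0 qE.
rewrite -/(A s) -/(A 0) As addrC addKr /H /GRing.scale /=.
have -> : s * d * (W be + (0 + be * eta)) - s * d * (W al + (0 + al * eta)) =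
    s * (- (d * ((W al - W be) / 2))).
  by rewrite /eta; field; rewrite gt_eqF.
rewrite ler_pM2l//; move: qs; rewrite subr0 ltr_norml => /andP[h _].
by rewrite leNgt h.
Qed.

End Variation.
End Curve.
End CriticalCurves.

(** * Localization at two instants and conclusion *)

Section NoetherTheorem.
Variable R : realType.

Lemma curve_derive_ge0 (f : R -> R^o) (t : R) (v : R^o) :
  {homo f : x y / x <= y} -> is_curve_derive f t v -> 0 <= v.
Proof.
move=> fle /is_curve_deriveP [q [qv _ qE]]; rewrite leNgt; apply/negP => v0.
have nv0 : 0 < - v by rewrite oppr_gt0.
have [r r0 Hr] := (near_realP _ _).1 (cvg_cseminorm _ (cseminorm_abs R) nv0 qv).
have r20 : 0 < r / 2 by rewrite divr_gt0.
have : `|q (r / 2) - v| < - v by apply: Hr; rewrite subr0 gtr0_norm//; lra.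
rewrite ltr_norml => /andP[_ qr].
have : f t <= f (r / 2 + t) by apply: fle; rewrite lerDr ltW.
rewrite qE lerDl /GRing.scale /= pmulr_rge0//; lra.
Qed.

Definition step_at (t0 r t : R) : R^o := smooth_step (- (t0 / r) + t * r^-1).

Section StepAt.
Variables (t0 r : R).
Hypothesis r0 : 0 < r.

Let argE t : - (t0 / r) + t * r^-1 = (t - t0) / r.
Proof. by rewrite mulrBl addrC. Qed.

Lemma smooth_step_at : smooth_curve setT (step_at t0 r).
Proof.
apply: (@smooth_curve_comp R R^o setT setT) => //; last exact: smooth_smooth_step.
exact: smooth_curve_line.
Qed.

Lemma step_at0 t : t <= t0 - r -> step_at t0 r t = 0.
Proof.
move=> tr; rewrite /step_at argE smooth_step0// ler_pdivrMr// mulN1r.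
by rewrite lerBlDl.
Qed.

Lemma step_at1 t : t0 <= t -> step_at t0 r t = 1.
Proof. by move=> tr; rewrite /step_at argE smooth_step1// divr_ge0 ?subr_ge0// ltW. Qed.

Lemma step_at_le : {homo step_at t0 r : x y / x <= y}.
Proof.
move=> x y xy; apply: smooth_step_le; rewrite !argE ler_pM2r ?invr_gt0//.
by rewrite lerD2r.
Qed.

Lemma step_at_itv t : 0 <= step_at t0 r t <= 1.
Proof.
apply/andP; split.
  have [h|h] := leP t (t0 - r); first by rewrite step_at0.
  by rewrite -(step_at0 (lexx _)) step_at_le// ltW.
have [h|h] := leP t0 t; first by rewrite step_at1.
by rewrite -(step_at1 (lexx _)) step_at_le// ltW.
Qed.

Lemma step_at_derive_ge0 t : 0 <= curve_derive (step_at t0 r) t.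
Proof.
exact: curve_derive_ge0 step_at_le (smooth_curve_deriveP smooth_step_at Logic.I).
Qed.

Lemma step_at_derive0 t : r < `|t - t0| -> curve_derive (step_at t0 r) t = 0.
Proof.
rewrite lter_normr => /orP[h|h]; apply: curve_deriveE => //.
  apply: (@near_is_curve_derive R R^o (fun=> 1)); last exact: is_curve_derive_cst.
  have tt : t0 < t by rewrite -subr_gt0 (lt_trans r0).
  by apply: (open_near (@open_gt R t0) tt) => s /= /ltW /step_at1.
apply: (@near_is_curve_derive R R^o (fun=> 0)); last exact: is_curve_derive_cst.
have tt : t < t0 - r by rewrite ltrBrDl -ltrBrDr (lt_le_trans h)// opprB.
by apply: (open_near (@open_lt R (t0 - r)) tt) => s /= /ltW /step_at0.
Qed.

End StepAt.

Variables (E : tvsType R) (N : set E) (L : E * E -> R^o) (X : E -> E) (F : E -> R^o).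
Hypotheses (hE : hausdorff_space E) (oN : open N).
Hypotheses (sL : smooth_map (N `*` [set: E]) L) (sX : smooth_map N X).
Hypothesis sF : smooth_map N F.

(** Here [a], [b] are the derivatives of the two steps, [j] the Noether function, [f] the value of F
    on the curve; the right side is the derivative of the [W] chosen below, with [u] and [v] the
    shifted values of the charge. *)
Lemma noether_charge_aux (a b j f f' ph u v : R) :
  a * (j - f - u) <= 0 -> b * (v - (j - f)) <= 0 ->
  ph * f' + (a - b) * j <= (a - b) * f + ph * f' + (u * a + - v * b).
Proof. lra. Qed.

(** No order between [t1] and [t2] is assumed, so exchanging them gives equality. The derivative of
    [phi] lives near the two instants, where continuity pins the charge [m] to within [e] of [m t1]
    or [m t2]. *)
Lemma noether_charge_le (I : set R) (c : R -> E) (t1 t2 : R) :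
  invariant_up_to N L X F -> open I -> is_interval I -> critical N L I c ->
  I t1 -> I t2 ->
  noether L X (velocity_lift c t2) - F (c t2) <=
  noether L X (velocity_lift c t1) - F (c t1).
Proof.
move=> inv oI iI crit It1 It2; have [sc cN _] := crit.
pose m t : R := noether L X (velocity_lift c t) - F (c t).
rewrite -/(m t1) -/(m t2) leNgt; apply/negP => m12.
(* With a third of the gap, [W be - W al = m t1 - m t2 + 2 * e = - e] is still negative. *)
pose e := (m t2 - m t1) / 3.
have e0 : 0 < e by rewrite divr_gt0// subr_gt0.
have sFc : smooth_curve I (fun t => F (c t)) by exact: smooth_map_curve sF sc cN.
have mc t : I t -> exists2 r : R, 0 < r &
    forall s, `|s - t| < r -> I s /\ `|m s - m t| < e.
  move=> It; have cm : {for t, continuous (m : R^o -> R^o)}.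
    have c1 := noether_continuous hE sL sX oI sc cN It.
    have c2 : {for t, continuous (fun s : R^o => F (c s) : R)}.
      exact: smooth_curve_continuous sFc It.
    exact: (continuousB c1 c2).
  have [r r0 Hr] := (near_realP _ _).1 (cvg_cseminorm _ (cseminorm_abs R) e0 cm).
  have [r' r0' Hr'] := (near_realP t I).1 (open_near oI It (fun s Is => Is)).
  exists (Order.min r r'); first by rewrite lt_min r0.
  by move=> s; rewrite lt_min => /andP[/Hr ? /Hr' ?].
have [r1 r10 Hr1] := mc t1 It1; have [r2 r20 Hr2] := mc t2 It2.
pose r := Order.min r1 r2 / 2.
have r0 : 0 < r by rewrite divr_gt0// lt_min r10.
have [rr1 rr2] : r < r1 /\ r < r2.
  have : r < Order.min r1 r2.
    by rewrite ltr_pdivrMr// ltr_pMr ?ltr1n// lt_min r10.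
  by rewrite lt_min => /andP.
(* The step at each instant rises during the preceding interval of length [r], so both steps are 0
   up to [al] and 1 from [be] on. *)
pose al := Order.min t1 t2 - r; pose be := Order.max t1 t2.
have [al1 al2] : al <= t1 - r /\ al <= t2 - r.
  by rewrite /al !lerD2r !ge_min !lexx orbT.
have [be1 be2] : t1 <= be /\ t2 <= be by rewrite /be !le_max !lexx orbT.
have ab : al < be by lra.
have Ial : I al.
  rewrite /al; case: (leP t1 t2) => _.
    by have [] // := Hr1 (t1 - r) _; rewrite addrAC subrr add0r normrN gtr0_norm.
  by have [] // := Hr2 (t2 - r) _; rewrite addrAC subrr add0r normrN gtr0_norm.
have Ibe : I be by rewrite /be; case: (leP t1 t2).
have KI : `[al, be]%classic `<=` I.
  by move=> t /=; rewrite in_itv /= => /iI; apply.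
pose th1 := step_at t1 r; pose th2 := step_at t2 r.
have s1 : smooth_curve I th1 by apply: smooth_curveW (@smooth_step_at t1 r).
have s2 : smooth_curve I th2 by apply: smooth_curveW (@smooth_step_at t2 r).
pose phi t : R^o := th1 t + (-1 : R) *: th2 t.
have sphi : smooth_curve setT phi.
  apply: (@smooth_curveD R R^o) => //; first exact: smooth_step_at.
  apply: (@smooth_curveZ R R^o setT (fun=> -1)) => //; last exact: smooth_step_at.
  exact: smooth_curve_cst.
have phi1 t : `|phi t| <= 1.
  have := step_at_itv t1 r0 t; have := step_at_itv t2 r0 t.
  by rewrite /phi /th1 /th2 scaleN1r ler_norml; lra.
have phi0 t : ~ `[al, be]%classic t -> phi t = 0.
  move=> /= /negP; rewrite in_itv /= negb_and -!ltNge => /orP[h|h]; rewrite /phi.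
    by rewrite /th1 /th2 !step_at0 ?scaler0 ?addr0//; lra.
  by rewrite /th1 /th2 !step_at1 ?scaleN1r ?subrr//; lra.
(* The first term yields phi (F o c)' + phi' F o c; in the others, [m t1 + e] and [m t2 - e] replace
   the charge where the respective step rises. As [phi] vanishes at [al] and [be], only these
   constants enter the increment of [W]. *)
pose W t : R^o := phi t *: F (c t) +
  ((m t1 + e : R^o) *: th1 t + (- (m t2 - e) : R^o) *: th2 t).
have dW t : I t -> is_curve_derive W t
    (curve_derive phi t *: F (c t) + phi t *: curve_derive (fun s => F (c s)) t +
     ((m t1 + e : R^o) *: curve_derive th1 t +
      (- (m t2 - e) : R^o) *: curve_derive th2 t)).
  move=> It; apply: is_curve_deriveD.
    exact: is_curve_deriveZ (smooth_curve_deriveP sphi Logic.I)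
      (smooth_curve_deriveP sFc It).
  apply: is_curve_deriveD.
    have := is_curve_deriveZ (is_curve_derive_cst (m t1 + e : R^o) t)
      (smooth_curve_deriveP s1 It).
    by rewrite scale0r add0r.
  have := is_curve_deriveZ (is_curve_derive_cst (- (m t2 - e) : R^o) t)
    (smooth_curve_deriveP s2 It).
  by rewrite scale0r add0r.
have dphi t : I t -> curve_derive phi t = curve_derive th1 t - curve_derive th2 t.
  move=> It; apply: curve_deriveE => //; apply: is_curve_deriveD.
    exact: smooth_curve_deriveP It.
  have := is_curve_deriveZ (is_curve_derive_cst (-1 : R^o) t)
    (smooth_curve_deriveP s2 It).
  by rewrite scale0r add0r scaleN1r.
have sW : smooth_curve I W.
  have cst (a : R^o) : smooth_curve I (fun=> a) by exact: smooth_curve_cst.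
  have hR := @hausdorff_Ro R.
  have p0 := smooth_curveZ hR oI (smooth_curveW (@subsetT _ I) sphi) sFc.
  have p1 := smooth_curveZ hR oI (cst (m t1 + e)) s1.
  have p2 := smooth_curveZ hR oI (cst (- (m t2 - e))) s2.
  exact: smooth_curveD hR oI p0 (smooth_curveD hR oI p1 p2).
have [d d0 tube] := curve_tube hE oN sX oI sc cN (@segment_compact R al be) KI.
have : W al <= W be.
  apply: (noether_first_variation hE oN sL sX oI sc cN ab KI d0 sphi phi1 phi0 tube
    crit sW) => t Kt; have It := KI t Kt.
  rewrite (curve_deriveE (@hausdorff_Ro R) (dW t It)) /variation_velocity.
  rewrite (invariant_differential hE oN sL sX sF oI sc cN _ _ inv It) dphi//.
  (* Either [t] is close to [t1] and the charge is below [m t1 + e], or the step is locally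
     constant. *)
  have g1 : curve_derive th1 t * (m t - (m t1 + e)) <= 0.
    have [tr|tr] := leP `|t - t1| r; last by rewrite /th1 step_at_derive0// mul0r.
    rewrite mulr_ge0_le0 ?step_at_derive_ge0//.
    have [_] := Hr1 t (le_lt_trans tr rr1); rewrite ltr_norml; lra.
  have g2 : curve_derive th2 t * ((m t2 - e) - m t) <= 0.
    have [tr|tr] := leP `|t - t2| r; last by rewrite /th2 step_at_derive0// mul0r.
    rewrite mulr_ge0_le0 ?step_at_derive_ge0//.
    have [_] := Hr2 t (le_lt_trans tr rr2); rewrite ltr_norml; lra.
  exact: noether_charge_aux g1 g2.
rewrite /W /phi /th1 /th2 !(step_at0 r0 al1, step_at0 r0 al2, step_at1 r0 be1, step_at1 r0 be2).
by rewrite /e /GRing.scale /=; lra.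
Qed.

Lemma noether_charge_constant : invariant_up_to N L X F ->
  constant_along_critical N L (fun p => noether L X p - F p.1).
Proof.
move=> inv I c oI iI crit t1 t2 It1 It2; apply/eqP; rewrite eq_le.
by apply/andP; split; apply: (noether_charge_le inv oI iI crit).
Qed.

End NoetherTheorem.

Theorem theorem4p2 (R : realType) (E : tvsType R) (N : set E)
    (L : E * E -> R^o) (X : E -> E) (F : E -> R^o) :
  frechet E -> open N ->
  smooth_map (N `*` [set: E]) L -> smooth_map N X -> smooth_map N F ->
  (invariant_up_to N L X F ->
     constant_along_critical N L (fun p : E * E => noether L X p - F p.1))
  /\ (infinitesimally_invariant N L X ->
     constant_along_critical N L (noether L X)).
Proof.
move=> /frechet_hausdorff hE oN sL sX sF; split=> inv.
  exact: noether_charge_constant inv.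
move=> I c oI iI crit t1 t2 It1 It2.
have s0 : smooth_map N (fun=> 0 : R^o).
  by move=> c' _ _; exact: (@smooth_curve_cst R R^o setT 0).
have := noether_charge_constant hE oN sL sX s0 inv oI iI crit It1 It2.
by rewrite !subr0.
Qed.
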